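(* Let $(\Omega,\mathcal F,\mathbb P)$ be a probability space and let $f_1,f_2,\dots$ be real-valued measurable functions on $\Omega$. (i) Suppose that for some subsequence $(f_{k_n})_{n\in\mathbb N}$ and some sets $A_1\subseteq A_2\subseteq\cdots$ in $\mathcal F$ with $\lim_{j\to\infty}\mathbb P(A_j)=1$ we have, for every $j\in\mathbb N$, $\sup_{n\in\mathbb N}\mathbb E^{\mathbb P}\big(|f_{k_n}|\mathbf 1_{A_j}\big)<\infty$. Then there exist a measurable function $f_*:\Omega\to\mathbb R$ and a further subsequence $(f_{k'_n})_{n}$ of $(f_{k_n})_n$ such that, for $(f_{k'_n})_n$ and for every subsequence $(f_{m_n})_n$ of it, $\lim_{N\to\infty}\frac1N\sum_{n=1}^N f_{m_n}=f_*$ holds $\mathbb P$-a.e. (ii) Conversely, suppose that for some subsequence $(f_{k_n})_n$ and some measurable $f_*:\Omega\to\mathbb R$, along $(f_{k_n})_n$ and along each of its subsequences $(f_{m_n})_n$ we have $\lim_{N\to\infty}\frac1N\sum_{n=1}^N f_{m_n}=f_*$ $\mathbb P$-a.e. Then there exist sets $A_1\subseteq A_2\subseteq\cdots$ in $\mathcal F$ with $\lim_{j\to\infty}\mathbb P(A_j)=1$ and a subsequence $(f_{k'_n})_n$ of $(f_{k_n})_n$ such that $\sup_{n\in\mathbb N}\mathbb E^{\mathbb P}\big(|f_{k'_n}|\mathbf 1_{A_j}\big)<\infty$ for every $j\in\mathbb N$. (iii) The following are equivalent: (a) there exist a subsequence $(f_{k_n})_n$ and sets $A_1\subseteq A_2\subseteq\cdots$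 in $\mathcal F$ with $\lim_j\mathbb P(A_j)=1$ such that $\sup_n\mathbb E^{\mathbb P}(|f_{k_n}|\mathbf 1_{A_j})<\infty$ for every $j$; (b) there exist a probability measure $\mathbb Q$ on $(\Omega,\mathcal F)$ equivalent to $\mathbb P$ and a subsequence $(f_{k_n})_n$ which is bounded in $L^1(\mathbb Q)$, i.e. $\sup_n\mathbb E^{\mathbb Q}(|f_{k_n}|)<\infty$. *)

(* Defs.v *)
From HB Require Import structures.
From mathcomp Require Import all_boot all_order all_algebra.
From mathcomp Require Import all_classical all_reals all_analysis.
Set Implicit Arguments. Unset Strict Implicit. Unset Printing Implicit Defensive.
Import Order.TTheory GRing.Theory Num.Theory numFieldNormedType.Exports.
Local Open Scope classical_set_scope.
Local Open Scope ring_scope.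

Definition strictly_incr (k : nat -> nat) : Prop := forall n, (k n < k n.+1)%N.

(* Cesaro mean (1/N) * sum_{n=1}^{N} g_{m_n}(x), written with N.+1 terms
   (indices shifted to start at 0). *)
Definition cesaro {T} {R : realType} (f : nat -> T -> R) (m : nat -> nat)
  (x : T) (N : nat) : R :=
  (N.+1%:R)^-1 * \sum_(n < N.+1) f (m n) x.

Definition cesaro_ae {d} {T : measurableType d} {R : realType}
  (P : {measure set T -> \bar R}) (f : nat -> T -> R) (m : nat -> nat)
  (fs : T -> R) : Prop :=
  {ae P, forall x, cesaro f m x @ \oo --> fs x}.

Definition hereditary_cesaro {d} {T : measurableType d} {R : realType}
  (P : {measure set T -> \bar R}) (f : nat -> T -> R) (k : nat -> nat)
  (fs : T -> R) : Prop :=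
  cesaro_ae P f k fs /\
  forall psi, strictly_incr psi -> cesaro_ae P f (k \o psi) fs.

Definition exhausting {d} {T : measurableType d} {R : realType}
  (P : {measure set T -> \bar R}) (A : nat -> set T) : Prop :=
  (forall j, measurable (A j)) /\ (forall j, A j `<=` A j.+1) /\
  ((fun j => P (A j)) @ \oo --> 1%E).

Definition locally_L1_bounded {d} {T : measurableType d} {R : realType}
  (P : {measure set T -> \bar R}) (f : nat -> T -> R) (k : nat -> nat)
  (A : nat -> set T) : Prop :=
  forall j, (ereal_sup (range (fun n =>
     \int[P]_x ((`|f (k n) x| * \1_(A j) x)%:E))) < +oo)%E.

(* Main.v *)
Require Import Defs.
From HB Require Import structures.
From mathcomp Require Import all_boot all_order all_algebra.
From mathcomp Require Import all_classical all_reals all_analysis.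
From mathcomp Require Import measurable_realfun.
From mathcomp Require Import ring lra zify.
Import Order.TTheory GRing.Theory Num.Theory numFieldNormedType.Exports.
Set Implicit Arguments. Unset Strict Implicit. Unset Printing Implicit Defensive.
Local Open Scope classical_set_scope.
Local Open Scope ring_scope.

(** Komlos' theorem is proved by an Etemadi-type argument.  For [f n >= 0] bounded in [L^1],
    write [min (f n) a] as the sum of the layers [min (f n) (b+1) - min (f n) b], [b < a].
    An ultrafilter gives every sequence of layers a weak limit [q b] (a Radon-Nikodym density),
    and a diagonal choice of indices makes the truncated, centred functions almost
    uncorrelated, so that second moments and monotonicity along lacunary subsequences give
    convergence of the Cesaro means of every subsequence to [\sum_b q b].

    For the converse, with [f n] replaced by [`|f n|], let [beta N = \sum_(b < N) q b] and
    [w N = 1 / (1 + beta N)].  Along a suitable subsequence [m] the sums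
    [\sum_(N < K) w N * (layer N (f (m N)) - q N)] are bounded in [L^2]; hereditary Cesaro
    convergence forces [f (m N) <= N] eventually, so the layers vanish and [\sum_N w N * q N]
    cannot diverge.  As in Abel-Dini, this means [\sum_b q b < oo] a.e., and the weight
    [1 / (1 + \sum_b q b)] localises an [L^1] bound. *)

(** * Bounded random variables *)

(** The [L^1] bounds are only local: they hold on each [A j]. Reweighting [P] into an equivalent [Q]
    makes the bound global, and almost everywhere statements do not see the change of measure, so
    (i) becomes Komlos' theorem under [Q].

    The diagonal choice tests each new function against functions built from those already chosen,
    so the test functions cannot be listed beforehand. An ultrafilter has limits against all bounded
    test functions at once, with no separability of the sigma-algebra; indices are then extracted in
    one pass.

    One extraction must serve every subsequence. The [n]-th term of a subsequence [psi] is truncated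
    at [n.+1] although it was chosen at stage [psi n >= n]. Hence the conditions at stage [N] cover
    all levels up to [N.+1], and their error terms decrease in [N].

    The converse has no integrability to start from, and [\sum_b q b] might be infinite. The weight
    [w N] makes the second moments summable regardless, before any finiteness is known. *)

Section bounded_expectation.
Context d (T : measurableType d) (R : realType) (P : probability T R).
Implicit Types u v : T -> R.

(** Only truncations enter the moment estimates. A bound at every point, unlike integrability, is
    stable under products, so side conditions reduce to closure rules. *)
Definition bounded_mfun u :=
  measurable_fun setT u /\ exists M : R, forall x, `|u x| <= M.

Local Notation E u := (Rintegral P setT u).

Lemma bounded_mfun_integrable u :
  bounded_mfun u -> P.-integrable setT (EFin \o u).
Proof.
case=> mu [M uM]; apply: measurable_bounded_integrable => //.
  by rewrite -ge0_fin_numE ?measure_ge0 ?fin_num_measure.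
exists M; split; first exact: num_real.
by move=> N MN x _ /=; exact: le_trans (uM x) (ltW MN).
Qed.

Lemma bounded_mfun_cst (r : R) : bounded_mfun (fun=> r).
Proof. by split; [exact: measurable_cst | exists `|r|]. Qed.

Lemma bounded_mfunD u v :
  bounded_mfun u -> bounded_mfun v -> bounded_mfun (fun x => u x + v x).
Proof.
move=> [mu [M uM]] [mv [N vN]]; split; first exact: measurable_funD.
by exists (M + N) => x; apply: le_trans (ler_normD _ _) _; exact: lerD.
Qed.

Lemma bounded_mfunM u v :
  bounded_mfun u -> bounded_mfun v -> bounded_mfun (fun x => u x * v x).
Proof.
move=> [mu [M uM]] [mv [N vN]]; split; first exact: measurable_funM.
by exists (M * N) => x; rewrite normrM; apply: ler_pM.
Qed.

Lemma bounded_mfunN u : bounded_mfun u -> bounded_mfun (fun x => - u x).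
Proof.
move=> [mu [M uM]]; split; first exact: measurable_funN.
by exists M => x; rewrite normrN.
Qed.

Lemma bounded_mfunB u v :
  bounded_mfun u -> bounded_mfun v -> bounded_mfun (fun x => u x - v x).
Proof. by move=> bu bv; apply: bounded_mfunD => //; exact: bounded_mfunN. Qed.

Lemma bounded_mfunZ (r : R) u :
  bounded_mfun u -> bounded_mfun (fun x => r * u x).
Proof. by apply: bounded_mfunM; exact: bounded_mfun_cst. Qed.

Lemma bounded_mfun_sum (F : nat -> T -> R) n :
  (forall i, bounded_mfun (F i)) -> bounded_mfun (fun x => \sum_(i < n) F i x).
Proof.
move=> bF; elim: n => [|n IHn].
  by under eq_fun do rewrite big_ord0; exact: bounded_mfun_cst.
by under eq_fun do rewrite big_ord_recr; exact: bounded_mfunD.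
Qed.

Lemma bounded_mfunX u n : bounded_mfun u -> bounded_mfun (fun x => u x ^+ n).
Proof.
move=> bu; elim: n => [|n IHn].
  by under eq_fun do rewrite expr0; exact: bounded_mfun_cst.
by under eq_fun do rewrite exprS; exact: bounded_mfunM.
Qed.

Lemma bounded_mfun_indic A : measurable A -> bounded_mfun (\1_A : T -> R).
Proof.
move=> mA; split; first exact: measurable_indic.
by exists 1 => x; rewrite indicE; case: (_ \in _); rewrite ?normr1 ?normr0.
Qed.

Lemma bounded_mfun_ge0 u M : measurable_fun setT u ->
  (forall x, 0 <= u x <= M) -> bounded_mfun u.
Proof.
move=> mu uM; split => //; exists M => x.
by have /andP[u0 uM'] := uM x; rewrite ger0_norm.
Qed.

Lemma expectD u v : bounded_mfun u -> bounded_mfun v ->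
  E (fun x => u x + v x) = E u + E v.
Proof. by move=> bu bv; rewrite RintegralD//; exact: bounded_mfun_integrable. Qed.

Lemma expectB u v : bounded_mfun u -> bounded_mfun v ->
  E (fun x => u x - v x) = E u - E v.
Proof. by move=> bu bv; rewrite RintegralB//; exact: bounded_mfun_integrable. Qed.

Lemma expectZ r u : bounded_mfun u -> E (fun x => r * u x) = r * E u.
Proof. by move=> bu; rewrite RintegralZl//; exact: bounded_mfun_integrable. Qed.

Lemma expect_cst r : E (fun=> r) = r.
Proof.
rewrite Rintegral_cst//; have /(congr1 fine)/= := probability_setT P.
by move=> h; rewrite -[RHS]mulr1; congr (_ * _).
Qed.

Lemma expect_ge0 u : (forall x, 0 <= u x) -> 0 <= E u.
Proof. by move=> u0; apply: Rintegral_ge0 => x _. Qed.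

Lemma le_expect u v : bounded_mfun u -> bounded_mfun v ->
  (forall x, u x <= v x) -> E u <= E v.
Proof.
by move=> bu bv uv; apply: le_Rintegral => //; exact: bounded_mfun_integrable.
Qed.

Lemma eq_expect u v : u =1 v -> E u = E v.
Proof. by move=> uv; apply: eq_Rintegral => x _. Qed.

Lemma expect_sum (F : nat -> T -> R) n : (forall i, bounded_mfun (F i)) ->
  E (fun x => \sum_(i < n) F i x) = \sum_(i < n) E (F i).
Proof.
move=> bF; elim: n => [|n IHn].
  rewrite big_ord0 -[RHS]expect_cst; apply: eq_expect => x.
  by rewrite big_ord0.
rewrite big_ord_recr /= -IHn -expectD//; last exact: bounded_mfun_sum.
by apply: eq_expect => x; rewrite big_ord_recr.
Qed.

Lemma expect_norm_le u M :
  bounded_mfun u -> (forall x, `|u x| <= M) -> `|E u| <= M.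
Proof.
move=> bu uM; rewrite ler_norml; apply/andP; split.
  rewrite -(expect_cst (- M)); apply: le_expect => //; first exact: bounded_mfun_cst.
  by move=> x; move: (uM x); rewrite ler_norml => /andP[].
rewrite -[leRHS](expect_cst M); apply: le_expect => //; first exact: bounded_mfun_cst.
by move=> x; move: (uM x); rewrite ler_norml => /andP[].
Qed.

Lemma expect_EFin u : bounded_mfun u -> (E u)%:E = (\int[P]_x (u x)%:E)%E.
Proof.
move=> /bounded_mfun_integrable iu; rewrite /Rintegral fineK//.
exact: integrable_fin_num.
Qed.

Lemma expect_indic A : measurable A ->
  (E (\1_A))%:E = (P : {measure set T -> \bar R}) A.
Proof.
move=> mA; rewrite expect_EFin; last exact: bounded_mfun_indic.
by rewrite integral_indic// setIT.
Qed.

End bounded_expectation.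

#[global] Hint Resolve bounded_mfun_cst bounded_mfunD bounded_mfunM bounded_mfunN
  bounded_mfunB bounded_mfun_sum bounded_mfunX : core.

(** * Almost everywhere bounds from bounds in mean *)

Section ae_bounds.
Context d (T : measurableType d) (R : realType) (P : probability T R).

(* By Fatou's lemma. *)
Lemma ae_frequently_bounded (Z : nat -> T -> R) (C : R) :
  (forall n, bounded_mfun (Z n)) -> (forall n x, 0 <= Z n x) ->
  (forall n, Rintegral P setT (Z n) <= C) ->
  {ae P, forall x, exists M, forall N, exists2 n, (N <= n)%N & Z n x <= M}.
Proof.
move=> bZ Z0 ZC; pose F x := limn_einf (fun n => (Z n x)%:E).
have mZ n : measurable_fun setT (EFin \o Z n) by apply/measurable_EFinP; case: (bZ n).
have mF : measurable_fun setT F.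
  rewrite /F /limn_einf; apply: measurableT_comp => //.
  apply: measurable_fun_limn_esup => n; exact: measurableT_comp (mZ n).
have F0 x : (0 <= F x)%E.
  rewrite /F limn_einf_lim; apply: lime_ge; first exact: is_cvg_einfs.
  by apply: nearW => n; apply: le_ereal_inf_tmp => _ [k _ <-]; rewrite lee_fin.
have iF : P.-integrable setT F.
  apply/integrableP; split => //.
  under eq_integral do rewrite gee0_abs//.
  apply: (@le_lt_trans _ _ C%:E); last exact: ltry.
  apply: le_trans (fatou P measurableT mZ _) _ => //.
    by move=> n x _; rewrite lee_fin.
  rewrite limn_einf_lim; apply: lime_le; first exact: is_cvg_einfs.
  apply: nearW => n; apply: (@le_trans _ _ (\int[P]_x (Z n x)%:E)%E).
    by apply: ereal_inf_lbound; exists n => /=.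
  by rewrite -expect_EFin// lee_fin.
have := integrable_ae measurableT iF.
apply: filterS => x /(_ Logic.I) Fx.
apply: contrapT => /forallNP nM.
suff : F x = +oo%E by move=> Fy; rewrite Fy in Fx.
rewrite /F; apply: (cvg_limn_einf_sup _).1.
apply/cvgeryP/cvgryPge => M.
have /existsNP[N HN] := nM M.
exists N => // n /= Nn; rewrite leNgt; apply/negP => /ltW ZM; apply: HN.
by exists n.
Qed.

(** Partial sums of nonnegative terms increase, so a bound at arbitrarily large indices is a bound
    at all indices. *)
Lemma ae_bounded_sums (g : nat -> T -> R) (C : R) :
  (forall n, bounded_mfun (g n)) -> (forall n x, 0 <= g n x) ->
  (forall n, \sum_(i < n) Rintegral P setT (g i) <= C) ->
  {ae P, forall x, exists M, forall n, \sum_(i < n) g i x <= M}.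
Proof.
move=> bg g0 gC.
apply: (filterS _ (@ae_frequently_bounded (fun n x => \sum_(i < n) g i x) C _ _ _)).
  move=> x [M MP]; exists M => n.
  have [m nm] := MP n; apply: le_trans; rewrite -(subnKC nm) big_split_ord /=.
  by rewrite lerDl sumr_ge0.
- by move=> n; exact: bounded_mfun_sum.
- by move=> n x; exact: sumr_ge0.
- by move=> n; rewrite expect_sum.
Qed.

Lemma bounded_sums_cvg0 (a : nat -> R) (M : R) : (forall n, 0 <= a n) ->
  (forall n, \sum_(i < n) a i <= M) -> a @ \oo --> 0.
Proof.
move=> a0 aM; apply: cvg_series_cvg_0.
apply: nondecreasing_is_cvgn.
  by apply/nondecreasing_seqP => n; rewrite /series/= big_nat_recr//= lerDl.
by exists M => _ [n _ <-]; rewrite /series/= big_mkord.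
Qed.

End ae_bounds.

(** The image of the ultrafilter has a cluster point in the compact segment [[- M, M]], and an
    ultrafilter converges to each of its cluster points. *)
Lemma ultra_bounded_cvg (R : realType) (U : set_system nat) (s : nat -> R) (M : R) :
  UltraFilter U -> (forall n, `|s n| <= M) -> exists l : R, s @ U --> l.
Proof.
move=> UU sM; have UP := @ultra_proper _ _ UU.
have UM : U (s @^-1` `[- M, M]%classic).
  by apply: (@filterE _ U) => n /=; rewrite in_itv/= -ler_norml.
have [p [_ clp]] := @segment_compact R (- M) M (s @ U) _ UM.
exists p => V pV; have [//|UV] := in_ultra_setVsetC (s @^-1` V) UU.
have [x [/= ]] := clp (~` V) V UV pV; by [].
Qed.

(** * Weak limits along an ultrafilter *)

Lemma eqfun_cvg (I : Type) (R : realType) (F : set_system I) (f g : I -> R) (l : R) :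
  f =1 g -> f @ F --> l -> g @ F --> l.
Proof. by move=> /funext ->. Qed.

(** The sum counts the naturals below both [v] and [n], which is [v] rounded up and capped at [n].
    The third bound carries the induction for the second. *)
Lemma sum_threshold_bounds (R : realType) (v : R) (n : nat) : 0 <= v ->
  Num.min v n%:R <= \sum_(i < n) (i%:R < v)%R%:R
    /\ \sum_(i < n) (i%:R < v)%R%:R <= v + 1 :> R
    /\ \sum_(i < n) (i%:R < v)%R%:R <= n%:R :> R.
Proof.
move=> v0; elim: n => [|n [IH1 [IH2 IH3]]].
  by rewrite !big_ord0 ge_min lexx orbT addr_ge0.
rewrite !big_ord_recr /=; have [nv|vn] := ltP n%:R v.
  rewrite (min_idPr (ltW nv)) in IH1.
  split; [|split].
  - by rewrite ge_min -natr1 lerD2r IH1 orbT.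
  - by rewrite lerD2r (le_trans IH3)// ltW.
  - by rewrite -natr1 lerD2r.
rewrite addr0; rewrite (min_idPl vn) in IH1; split; [|split] => //.
  by rewrite ge_min IH1.
by apply: le_trans IH3 _; rewrite ler_nat.
Qed.

(** Layer-cake approximation with mesh [e]: the sets are the level sets of [u], shifted to be
    nonnegative. It lets identities known on indicators pass to bounded functions. *)
Lemma bounded_mfun_approx d (T : measurableType d) (R : realType)
    (u : T -> R) (e : R) : bounded_mfun u -> 0 < e ->
  exists (c : R) (n : nat) (A : nat -> set T),
    (forall i, measurable (A i)) /\
    forall x, `|u x - (c + e * \sum_(i < n) \1_(A i) x)| <= e.
Proof.
move=> [mu [M uM]] e0.
pose v x := (u x + `|M|) / e.
have v0 x : 0 <= v x.
  rewrite divr_ge0 ?(ltW e0)// -[u x]opprK addrC subr_ge0.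
  by apply: le_trans (ler_norm _) _; rewrite normrN (le_trans (uM x))// ler_norm.
pose n := (Num.trunc (2 * `|M| / e)).+1.
have vn x : v x <= n%:R.
  apply: (@le_trans _ _ (2 * `|M| / e)); last exact/ltW/truncnS_gt.
  rewrite ler_pM2r ?invr_gt0// mulrDl mul1r lerD2r.
  by rewrite (le_trans (ler_norm _))// (le_trans (uM x))// ler_norm.
exists (- `|M|), n, (fun i => [set x | i%:R < v x]); split.
  move=> i; rewrite -[X in measurable X]setTI.
  have mv : measurable_fun setT v.
    by apply: measurable_funM => //; exact: measurable_funD.
  have := measurable_fun_ltr (@measurable_cst _ _ _ _ setT (i%:R : R)) mv.
  move=> /(_ measurableT [set true]); rewrite /preimage /=; exact.
move=> x.
have -> : \sum_(i < n) \1_[set x | i%:R < v x] x = \sum_(i < n) (i%:R < v x)%R%:R :> R.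
  by apply: eq_bigr => i _; rewrite indicE mem_setE.
have [h1 [h2 _]] := sum_threshold_bounds n (v0 x).
rewrite (min_idPl (vn x)) in h1.
set S := \sum_(i < n) _ in h1 h2 *.
have -> : u x - (- `|M| + e * S) = e * (v x - S).
  by rewrite /v mulrBr mulrCA divff ?gt_eqF// mulr1 opprD opprK addrA.
by rewrite normrM gtr0_norm// ger_pMr// ler_norml; lra.
Qed.

Section weak_limit.
Context d (T : measurableType d) (R : realType) (P : probability T R).
Variables (U : set_system nat) (h : nat -> T -> R).
Hypotheses (UU : UltraFilter U) (mh : forall n, measurable_fun setT (h n)).
Hypothesis (h01 : forall n x, 0 <= h n x <= 1).

Local Notation E u := (Rintegral P setT u).

Let UP : ProperFilter U := @ultra_proper _ _ UU.
Existing Instance UP.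

Let bh n : bounded_mfun (h n). Proof. exact: bounded_mfun_ge0 (h01 n). Qed.

Definition weak_lim (u : T -> R) : R := lim ((fun n => E (fun x => u x * h n x)) @ U).

Local Notation L := weak_lim.

Lemma weak_limP u : bounded_mfun u -> (fun n => E (fun x => u x * h n x)) @ U --> L u.
Proof.
move=> bu; have [_ [M uM]] := bu.
have [l sl] : exists l : R, (fun n => E (fun x => u x * h n x)) @ U --> l.
  apply: (@ultra_bounded_cvg _ _ _ M) => // n; apply: expect_norm_le; first by auto.
  move=> x; rewrite normrM -[leRHS]mulr1; have /andP[h0 h1] := h01 n x.
  by apply: ler_pM => //; rewrite ger0_norm.
by rewrite /weak_lim (cvg_lim _ sl).
Qed.

Lemma weak_limD u v : bounded_mfun u -> bounded_mfun v ->
  L (fun x => u x + v x) = L u + L v.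
Proof.
move=> bu bv; rewrite {1}/weak_lim; apply: cvg_lim => //.
apply: (eqfun_cvg _ (cvgD (weak_limP bu) (weak_limP bv))) => n /=.
rewrite fctE -expectD; [|by auto..].
by apply: eq_expect => x; rewrite mulrDl.
Qed.

Lemma weak_limZ r u : bounded_mfun u -> L (fun x => r * u x) = r * L u.
Proof.
move=> bu; rewrite {1}/weak_lim; apply: cvg_lim => //.
apply: (eqfun_cvg _ (cvgMl_tmp (weak_limP bu))) => n /=.
rewrite -expectZ; last by auto.
by apply: eq_expect => x; rewrite mulrA.
Qed.

Lemma weak_lim_ge0 u : bounded_mfun u -> (forall x, 0 <= u x) -> 0 <= L u.
Proof.
move=> bu u0; apply: (limr_ge (cvgP _ (weak_limP bu))); apply: nearW => n.
by apply: expect_ge0 => x; rewrite mulr_ge0//; have /andP[] := h01 n x.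
Qed.

Lemma weak_lim_le u : bounded_mfun u -> (forall x, 0 <= u x) -> L u <= E u.
Proof.
move=> bu u0; apply: (limr_le (cvgP _ (weak_limP bu))); apply: nearW => n.
apply: le_expect; auto => x; have /andP[_ h1] := h01 n x.
by rewrite -[leRHS]mulr1 ler_wpM2l.
Qed.

Lemma weak_lim_norm_le u M : bounded_mfun u -> (forall x, `|u x| <= M) ->
  `|L u| <= M.
Proof.
move=> bu uM.
have sb n : `|E (fun x => u x * h n x)| <= M.
  apply: expect_norm_le; first by auto.
  move=> x; rewrite normrM -[leRHS]mulr1; have /andP[h0 h1] := h01 n x.
  by apply: ler_pM => //; rewrite ger0_norm.
rewrite ler_norml; apply/andP; split.
  apply: (limr_ge (cvgP _ (weak_limP bu))); apply: nearW => n.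
  by have := sb n; rewrite ler_norml => /andP[].
apply: (limr_le (cvgP _ (weak_limP bu))); apply: nearW => n.
by have := sb n; rewrite ler_norml => /andP[].
Qed.

Lemma weak_lim_sum (F : nat -> T -> R) n : (forall i, bounded_mfun (F i)) ->
  L (fun x => \sum_(i < n) F i x) = \sum_(i < n) L (F i).
Proof.
move=> bF; elim: n => [|n IHn].
  rewrite big_ord0 -[RHS](mul0r (L (fun=> 0))) -weak_limZ; auto.
  by congr L; apply/funext => x; rewrite big_ord0 mul0r.
rewrite big_ord_recr /= -IHn -weak_limD//; auto.
by congr L; apply/funext => x; rewrite big_ord_recr.
Qed.

(* The hypotheses are arguments so that the charge structure can be inferred. *)
Definition weak_charge of UltraFilter U & (forall n, measurable_fun setT (h n))
  & (forall n x, 0 <= h n x <= 1) := fun A : set T => (L (\1_A))%:E.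
Local Notation nu := (weak_charge UU mh h01).

Let weak_charge0 : nu set0 = 0%E.
Proof.
congr EFin; rewrite -[RHS](mul0r (L (fun=> 0))) -weak_limZ; auto.
by congr L; apply/funext => x; rewrite indic0 mul0r.
Qed.

Let weak_charge_finite A : measurable A -> nu A \is a fin_num.
Proof. by []. Qed.

(** The defect on a disjoint union is the functional [L] at a nonnegative function, so it lies
    between 0 and the same defect for [P], which tends to 0. The bound [h <= 1] does the work of
    uniform integrability. *)
Let weak_charge_sigma_additive : semi_sigma_additive nu.
Proof.
move=> F mF tF mUF.
have bF i : bounded_mfun (\1_(F i) : T -> R) by exact: bounded_mfun_indic.
have bU : bounded_mfun (\1_(\bigcup_n F n) : T -> R) by exact: bounded_mfun_indic.
have FU n x : 0 <= \1_(\bigcup_n F n) x - \sum_(i < n) \1_(F i) x :> R.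
  rewrite subr_ge0; have [[i Fix]|nF] := pselect (exists i : 'I_n, F i x).
    rewrite (bigD1 i)//= big1 ?addr0.
      by rewrite !indicE !mem_set//; exists i.
    move=> j ji; rewrite indicE memNset// => Fjx.
    move/eqP: ji; apply; apply/val_inj.
    by apply: (tF j i) => //; exists x.
  rewrite big1 ?indicE// => i _; rewrite indicE memNset// => Fix.
  by apply: nF; exists i.
have Pcvg : (fun n => \sum_(i < n) E (\1_(F i))) @ \oo --> E (\1_(\bigcup_n F n)).
  have := @measure_semi_sigma_additive _ _ _ P F mF tF mUF.
  rewrite -expect_indic// => /fine_cvg; apply: eqfun_cvg => n /=.
  rewrite big_mkord; under [in LHS]eq_bigr do rewrite -expect_indic//.
  by rewrite sumEFin.
rewrite /weak_charge; under eq_fun do rewrite big_mkord sumEFin.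
apply/fine_cvgP; split; first exact: nearW.
have e0 : (fun n => E (\1_(\bigcup_n F n)) - \sum_(i < n) E (\1_(F i))) @ \oo --> 0.
  rewrite -[X in _ --> X](subrr (E (\1_(\bigcup_n F n)))).
  by apply: (eqfun_cvg _ (cvgB (cvg_cst _) Pcvg)) => n; rewrite !fctE.
have d0 : (fun n => L (\1_(\bigcup_n F n)) - \sum_(i < n) L (\1_(F i))) @ \oo --> 0.
  apply: (squeeze_cvgr _ (cvg_cst 0) e0); apply: nearW => n.
  have bS := bounded_mfun_sum n bF.
  rewrite -(weak_lim_sum n bF) -(expect_sum P n bF) -(expectB P bU bS).
  rewrite (_ : L _ - _ = L (fun x => \1_(\bigcup_n F n) x - \sum_(i < n) \1_(F i) x)).
    by rewrite weak_lim_ge0 ?weak_lim_le//; exact: bounded_mfunB.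
  rewrite -mulN1r -(weak_limZ _ bS) -(weak_limD bU (bounded_mfunZ _ bS)).
  by congr L; apply/funext => x; rewrite mulN1r.
rewrite -[L _]subr0; apply: (eqfun_cvg _ (cvgB (cvg_cst _) d0)) => n; rewrite !fctE /=.
by rewrite opprB addrC subrK.
Qed.

HB.instance Definition _ := isCharge.Build _ _ _ nu
  weak_charge0 weak_charge_finite weak_charge_sigma_additive.

Lemma weak_charge_dominated : nu `<< (P : {measure set T -> \bar R}).
Proof.
apply/null_content_dominatesP => A mA PA0.
have bA : bounded_mfun (\1_A : T -> R) by exact: bounded_mfun_indic.
have A0 x : 0 <= \1_A x :> R by rewrite indicE.
congr EFin; apply/eqP; rewrite eq_le weak_lim_ge0// andbT.
rewrite (le_trans (weak_lim_le bA A0))//.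
by rewrite -lee_fin expect_indic// PA0.
Qed.

End weak_limit.

Section weak_limit_density.
Context d (T : measurableType d) (R : realType) (P : probability T R).
Local Notation E u := (Rintegral P setT u).

(** Tested on the set where [g < 0], the hypothesis forces the integral of the absolute value of [g]
    there to vanish. *)
Lemma ae_ge0_of_integral_ge0 (g : T -> R) : P.-integrable setT (EFin \o g) ->
  (forall A, measurable A -> (0 <= \int[P]_(x in A) (g x)%:E)%E) ->
  {ae P, forall x, 0 <= g x}.
Proof.
move=> ig gA; have /measurable_EFinP mg := measurable_int P ig.
pose A := [set x | g x < 0].
have mA : measurable A.
  have /(_ measurableT [set true]) := measurable_fun_ltr mg (@measurable_cst _ _ _ _ setT (0 : R)).
  by rewrite setTI; exact.
have := gA A mA.
have mgA : measurable_fun A (EFin \o g).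
  by apply: measurable_funTS; exact/measurable_EFinP.
have ->: (\int[P]_(x in A) (g x)%:E = - \int[P]_(x in A) `|(EFin \o g) x|)%E.
  rewrite -integral_ge0N//; apply: eq_integral => x /set_mem gx.
  by rewrite /= ltr0_norm//= opprK.
rewrite oppe_ge0 => g0; have [+ _] := ae_eq_integral_abs P mA mgA.
have -> : (\int[P]_(x in A) `|(EFin \o g) x| = 0)%E.
  by apply/eqP; rewrite eq_le g0 integral_ge0.
move=> /(_ erefl).
apply: filterS => x h; rewrite leNgt; apply/negP => gx.
by have := h gx; move: gx => /[swap] -[->]; rewrite ltxx.
Qed.

(** [q] is the Radon-Nikodym density of [weak_charge]. The limit formula holds on indicators by
    construction and extends to bounded [u] by uniform approximation, since both sides are linear
    and bounded by the supremum of [u] in absolute value. *)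
Lemma weak_limit_density (U : set_system nat) (h : nat -> T -> R) :
  UltraFilter U -> (forall n, measurable_fun setT (h n)) ->
  (forall n x, 0 <= h n x <= 1) ->
  exists q : T -> R, [/\ measurable_fun setT q, (forall x, 0 <= q x <= 1) &
    forall u, bounded_mfun u ->
      (fun n => E (fun x => u x * h n x)) @ U --> E (fun x => u x * q x)].
Proof.
move=> UU mh h01.
pose L := weak_lim P U h.
pose nu : {charge set T -> \bar R} := weak_charge P UU mh h01.
have nuP : nu `<< (P : {measure set T -> \bar R}) by exact: weak_charge_dominated.
pose q0 x := fine (Radon_Nikodym nu P x).
have q0E : EFin \o q0 = Radon_Nikodym nu P.
  by apply/funext => x; rewrite /= fineK// Radon_Nikodym_fin_num.
have iq0 : P.-integrable setT (EFin \o q0).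
  by rewrite q0E; exact: Radon_Nikodym_integrable.
have q0A A : measurable A -> (\int[P]_(x in A) (q0 x)%:E = (L (\1_A))%:E)%E.
  move=> mA; have /= := Radon_Nikodym_integral nuP mA.
  by rewrite -q0E => <-.
have bI A : measurable A -> bounded_mfun (\1_A : T -> R) by exact: bounded_mfun_indic.
have I0 A x : 0 <= \1_A x :> R by rewrite indicE.
have q0_ge0 : {ae P, forall x, 0 <= q0 x}.
  apply: ae_ge0_of_integral_ge0 => // A mA.
  by rewrite q0A// lee_fin weak_lim_ge0//; exact: bI.
have q0_le1 : {ae P, forall x, 0 <= 1 - q0 x}.
  have i1 : P.-integrable setT (EFin \o (fun=> 1 : R)).
    exact/bounded_mfun_integrable/bounded_mfun_cst.
  apply: ae_ge0_of_integral_ge0.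
    by have := integrableB measurableT i1 iq0; apply: eq_integrable => // x _.
  move=> A mA; under eq_integral do rewrite EFinB.
  rewrite integralB//; [|exact: integrableS i1|exact: integrableS iq0].
  rewrite q0A// integral_cst//= mul1e -(expect_indic P mA) -EFinB lee_fin subr_ge0.
  by rewrite weak_lim_le//; exact: bI.
have mq0 : measurable_fun setT q0 by apply/measurable_EFinP/(measurable_int P).
(* The density lies in [[0, 1]] only almost everywhere; clamping makes the bounds hold at every
   point. *)
pose q x := Num.max 0 (Num.min (q0 x) 1).
have mq : measurable_fun setT q.
  by apply: measurable_maxr => //; exact: measurable_minr.
have q01 x : 0 <= q x <= 1.
  by rewrite /q le_max lexx ge_max ler01 ge_min lexx orbT.
have bq : bounded_mfun q by exact: bounded_mfun_ge0 q01.
exists q; split => // u bu.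
suff -> : E (fun x => u x * q x) = L u by exact: weak_limP.
have qA A : measurable A -> E (fun x => \1_A x * q x) = L (\1_A).
  move=> mA; apply: EFin_inj; rewrite -q0A// expect_EFin; last by apply: bounded_mfunM => //; exact: bI.
  rewrite [RHS]integral_mkcond; apply: ae_eq_integral => //.
  - by apply/measurable_EFinP; apply: measurable_funM.
  - apply/(measurable_restrictT _ mA); apply: measurable_funTS.
    exact/measurable_EFinP.
  - apply: filterS2 q0_ge0 q0_le1 => x qx0; rewrite subr_ge0 => qx1 _.
    rewrite /patch indicE; case: (x \in A); rewrite ?mul0r// mul1r /q.
    by rewrite (min_idPl qx1) (max_idPr qx0).
apply/eqP; rewrite -subr_eq0 -normr_le0; apply/ler_addgt0Pr => e e0; rewrite add0r.
have e20 : 0 < e / 2 by rewrite divr_gt0.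
have [c [n [A [mA uA]]]] := bounded_mfun_approx bu e20.
have bA i : bounded_mfun (\1_(A i) : T -> R) by exact: bI.
pose s0 x := \sum_(i < n) \1_(A i) x : R.
have bs0 : bounded_mfun s0 := bounded_mfun_sum n bA.
have bT : bounded_mfun (\1_setT : T -> R) by exact: bI.
(* Writing the constant as [c * \1_setT x] makes [s] a combination of indicators only, so that [qA]
   applies to every term. *)
pose s x := c * \1_setT x + e / 2 * s0 x.
have bs : bounded_mfun s by rewrite /s; auto.
have bqA i : bounded_mfun (fun x => \1_(A i) x * q x) by auto.
have bqT : bounded_mfun (fun x => \1_setT x * q x) by auto.
have sq : E (fun x => s x * q x) = L s.
  have -> : L s = c * L (\1_setT) + e / 2 * \sum_(i < n) L (\1_(A i)).
    rewrite /L -(weak_lim_sum P UU mh h01 n bA) -!(weak_limZ P UU mh h01)//.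
    by rewrite -(weak_limD P UU mh h01)//; auto.
  rewrite -(qA _ measurableT); under eq_bigr do rewrite -(qA _ (mA _)).
  rewrite -(expect_sum P n bqA) -!expectZ//; last exact: (bounded_mfun_sum n bqA).
  rewrite -expectD; [|exact: bounded_mfunZ|].
    apply: eq_expect => x; rewrite mulrDl -!mulrA; congr (_ + _ * _).
    by rewrite mulr_suml.
  exact: (bounded_mfunZ _ (bounded_mfun_sum n bqA)).
(* The two sides agree on [s], so only the remainder [u - s] is left; it contributes at most [e / 2]
   to each. *)
have -> : E (fun x => u x * q x) - L u =
    E (fun x => (u x - s x) * q x) - L (fun x => u x - s x).
  have -> : L u = L s + L (fun x => u x - s x).
    rewrite /L -(weak_limD P UU mh h01)//; last exact: bounded_mfunB.
    by congr weak_lim; apply/funext => x; rewrite addrC subrK.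
  rewrite -sq opprD addrA -expectB; [|by auto..]; congr (_ - _).
  by apply: eq_expect => x; rewrite mulrBl.
have su x : `|u x - s x| <= e / 2.
  by have := uA x; rewrite /s indicT mulr1.
rewrite (splitr e); apply: le_trans (ler_normB _ _) _; apply: lerD.
  apply: expect_norm_le; auto => x; rewrite normrM -[leRHS]mulr1.
  by have /andP[q_ge0 q_le1] := q01 x; apply: ler_pM => //; rewrite ger0_norm.
by apply: weak_lim_norm_le => //; auto.
Qed.

End weak_limit_density.

(** * Layers and lacunary sequences *)

Section layers.
Context (R : realType).
Implicit Types (t : R) (a n : nat).

Definition clip a t : R := Num.min t a%:R.

(** This is [t - a] clamped to [[0, 1]]. *)
Definition layer a t : R := clip a.+1 t - clip a t.

Lemma clip_bounds a t : 0 <= t -> 0 <= clip a t <= a%:R.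
Proof. by move=> t0; rewrite /clip le_min t0 ler0n ge_min lexx orbT. Qed.

Lemma layer_bounds a t : 0 <= layer a t <= 1.
Proof.
rewrite /layer /clip -natr1; have a0 := ler0n R a.
by rewrite /Num.min; case: ifPn; case: ifPn; lra.
Qed.

Lemma clip_sum a t : 0 <= t -> clip a t = \sum_(b < a) layer b t.
Proof.
move=> t0; elim: a => [|a IHa]; first by rewrite big_ord0 /clip (min_idPr t0).
by rewrite big_ord_recr /= -IHa /layer addrC subrK.
Qed.

Lemma layer_eq0 a t : t <= a%:R -> layer a t = 0.
Proof.
move=> ta; rewrite /layer /clip (min_idPl ta) (min_idPl _) ?subrr//.
by rewrite (le_trans ta)// ler_nat.
Qed.

(** Through this bound, layers tending to 0 make the truncation inactive from some index on; it
    stands in for a Borel-Cantelli argument. *)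
Lemma layer_lt1 a t : layer a t < 1 -> t < a.+1%:R.
Proof.
apply: contraTT; rewrite -!leNgt => at_.
rewrite /layer /clip (min_idPr at_) (min_idPr _); last first.
  by rewrite (le_trans _ at_)// ler_nat.
by rewrite -natr1; lra.
Qed.

Lemma clip_id a t : t <= a%:R -> clip a t = t.
Proof. by move=> ta; rewrite /clip (min_idPl ta). Qed.

(** Adding the term [p n] to a sum [S <= n] raises the square by [p n * (2 * S + p n)]. This is the
    discrete form of computing a second moment as the integral of [2 * t] against the tail. *)
Lemma sum_sq_le (p : nat -> R) n : (forall a, 0 <= p a <= 1) ->
  (\sum_(a < n) p a) ^+ 2 <= \sum_(a < n) (2 * a%:R + 1) * p a.
Proof.
move=> p01; elim: n => [|n IHn]; first by rewrite !big_ord0 expr0n.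
rewrite !big_ord_recr /=; set S := \sum_(a < n) _ in IHn *.
have S0 : 0 <= S by apply: sumr_ge0 => i _; have /andP[] := p01 i.
have Sn : S <= n%:R.
  rewrite -[n in n%:R]card_ord -sumr_const; apply: ler_sum => i _.
  by have /andP[] := p01 i.
have /andP[pn0 pn1] := p01 n.
have : p n * (S + S + p n) <= p n * (2 * n%:R + 1) by rewrite ler_wpM2l//; lra.
nra.
Qed.

End layers.

(** * Diagonal selection of indices *)

Lemma near_forall_lt (I : Type) (F : set_system I) (FF : Filter F)
    (A : nat -> I -> Prop) (n : nat) :
  (forall i, (i < n)%N -> \forall x \near F, A i x) ->
  \forall x \near F, forall i, (i < n)%N -> A i x.
Proof.
elim: n => [|n IHn] FA; first by apply: nearW => x i.
have := IHn (fun i ni => FA i (leqW ni)); apply: filterS2 (FA n (leqnn _)) => x An Ai i.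
by rewrite ltnS leq_eqVlt => /predU1P[->//|]; exact: Ai.
Qed.

(** Given the finite list of earlier choices, the next index faces finitely many conditions, each
    true on a member of [U]; properness yields a common index. The list is carried through the
    recursion because [Q] refers to all earlier choices. *)
Lemma diagonal_selection (U : set_system nat) (UP : ProperFilter U)
    (S : nat -> nat -> Prop) (Q : nat -> nat -> nat -> nat -> Prop) :
  \oo `<=` U ->
  (forall N, \forall n \near U, S N n) ->
  (forall M m N, (M < N)%N -> \forall n \near U, Q M m N n) ->
  exists m : nat -> nat, strictly_incr m /\
    forall N, S N (m N) /\ forall M, (M < N)%N -> Q M (m M) N (m N).
Proof.
move=> ooU US UQ.
pose good (s : seq nat) n := [/\ S (size s) n,
  forall M, (M < size s)%N -> Q M (nth 0%N s M) (size s) n &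
  forall M, (M < size s)%N -> (nth 0%N s M < n)%N].
have /choice[next nextP] : forall s, exists n, good s n.
  move=> s; apply: (@filter_ex _ U).
  have HQ : \forall n \near U, forall M, (M < size s)%N -> Q M (nth 0%N s M) (size s) n.
    by apply: near_forall_lt => M Ms; exact: UQ.
  have HL : \forall n \near U, forall M, (M < size s)%N -> (nth 0%N s M < n)%N.
    by apply: near_forall_lt => M Ms; apply: ooU; exact: nbhs_infty_gt.
  by apply: filterS3 (US (size s)) HQ HL => n *; split.
pose pre := fix pre N := if N is N'.+1 then rcons (pre N') (next (pre N')) else [::].
have size_pre N : size (pre N) = N by elim: N => //= N IH; rewrite size_rcons IH.
have nth_pre N M : (M < N)%N -> nth 0%N (pre N) M = next (pre M).
  elim: N => //= N IH; rewrite ltnS leq_eqVlt nth_rcons size_pre => /predU1P[->|MN].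
    by rewrite ltnn eqxx.
  by rewrite MN IH.
exists (fun N => next (pre N)); split.
  move=> N; have [_ _] := nextP (pre N.+1).
  by rewrite size_pre => /(_ N (leqnn _)); rewrite nth_pre.
move=> N; have [] := nextP (pre N); rewrite size_pre => SN QN _; split => // M MN.
by have := QN M MN; rewrite nth_pre.
Qed.

Lemma strictly_incr_lt (k : nat -> nat) : strictly_incr k ->
  {homo k : m n / (m < n)%N}.
Proof. by move=> kS; apply: homo_ltn => //; exact: ltn_trans. Qed.

Lemma strictly_incr_ge (k : nat -> nat) : strictly_incr k -> forall n, (n <= k n)%N.
Proof. by move=> kS; elim=> // n /leq_ltn_trans; apply; exact: kS. Qed.

Lemma strictly_incr_comp (k l : nat -> nat) :
  strictly_incr k -> strictly_incr l -> strictly_incr (k \o l).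
Proof. by move=> kS lS n; exact: strictly_incr_lt (lS n). Qed.

(** * Cesaro means along lacunary sequences *)

Section lacunary.
Context (R : realType).

(* Consecutive terms have ratio at least 1 + 1/L, tending to 1 + 1/L. *)
Fixpoint lacunary (L j : nat) : nat :=
  if j is j'.+1 then (lacunary L j' + lacunary L j' %/ L + 1)%N else 1%N.

Lemma lacunary_gt (L j : nat) : (j < lacunary L j)%N.
Proof. by elim: j => //= j IH; rewrite addn1 ltnS (leq_trans IH) ?leq_addr. Qed.

Lemma lacunary_ratio_ge (L j : nat) : (0 < L)%N ->
  L.+1%:R * (lacunary L j)%:R <= L%:R * (lacunary L j.+1)%:R :> R.
Proof.
move=> L0; rewrite -!natrM ler_nat /=; set N := lacunary L j.
have := ltn_ceil N L0; nia.
Qed.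

(** The [+ 1] of the recursion is at most [N / L] once [L <= N], so the ratio is at most
    [1 + 2 / L]. *)
Lemma lacunary_ratio_le (L j : nat) : (0 < L)%N -> (L <= j)%N ->
  L%:R * (lacunary L j.+1)%:R <= L.+2%:R * (lacunary L j)%:R :> R.
Proof.
move=> L0 Lj; rewrite -!natrM ler_nat /=.
have := lacunary_gt L j; set N := lacunary L j => jN.
have := leq_trunc_div N L; nia.
Qed.

Lemma lacunary_between (L n K : nat) : (lacunary L n <= K)%N ->
  exists2 j, (n <= j)%N & (lacunary L j <= K < lacunary L j.+1)%N.
Proof.
move=> nK.
have ex : exists j, (K < lacunary L j)%N by exists K; exact: lacunary_gt.
case: (ex_minnP ex) => j Kj minj.
have nj : (n < j)%N.
  rewrite ltnNge; apply/negP => jn.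
  suff : (lacunary L j <= lacunary L n)%N by lia.
  rewrite -(subnKC jn); elim: (n - j)%N => [|i IH]; first by rewrite addn0.
  by rewrite addnS /= -addnA (leq_trans IH)// leq_addr.
exists j.-1; first by lia.
have -> : j.-1.+1 = j by lia.
rewrite Kj andbT leqNgt; apply/negP => /minj; lia.
Qed.

(** [W n] will bound the second moment per term, and [G] the expectations of the layers. Instead of
    exchanging the two sums, the terms are shown to satisfy a contracting recursion whose increments
    telescope. *)
Lemma lacunary_sum_bounded (L : nat) (w A G : nat -> R) (C : R) : (0 < L)%N ->
  (forall n, 0 <= G n) -> (forall n, \sum_(a < n) G a <= C) ->
  let W n := 2 * \sum_(a < n) (2 * a%:R + 1) * G a + 3 in
  forall J, \sum_(j < J) W (lacunary L j) / (lacunary L j)%:R <=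
    L.+1%:R * (W 1%N + 4 * C).
Proof.
move=> L0 G0 GC W J.
pose B j := W (lacunary L j) / (lacunary L j)%:R.
pose Gam n := \sum_(a < n) G a.
have N0 j : 0 < (lacunary L j)%:R :> R.
  by rewrite ltr0n (leq_ltn_trans _ (lacunary_gt L j)).
have Wge0 n : 0 <= W n.
  rewrite /W addr_ge0// mulr_ge0// sumr_ge0// => a _.
  by rewrite mulr_ge0// addr_ge0// mulr_ge0.
have B0 j : 0 <= B j by rewrite divr_ge0// ltW.
(* Passing from [N] to [N'] divides the old part by at least [1 + 1 / L]. The new weights
   [2 * a + 1] are at most [2 * N'], so after division by [N'] the new part costs four times the
   increment of [Gam]. *)
have step j : L.+1%:R * B j.+1 <=
    L%:R * B j + L.+1%:R * (4 * (Gam (lacunary L j.+1) - Gam (lacunary L j))).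
  have NN : (lacunary L j <= lacunary L j.+1)%N by rewrite /= -addnA leq_addr.
  set N := lacunary L j in NN *; set N' := lacunary L j.+1 in NN *.
  have WW : W N' - W N <= 4 * N'%:R * (Gam N' - Gam N).
    rewrite /W /Gam -(subnKC NN); set k := (N' - N)%N.
    rewrite !big_split_ord /= opprD addrACA subrr addr0 -mulrBr.
    rewrite [X in 2 * X]addrAC subrr add0r [X in _ <= _ * X]addrAC subrr add0r.
    rewrite [X in _ <= X * _](_ : _ = 2 * (2 * (N + k)%:R)); last by ring.
    rewrite -mulrA ler_pM2l// mulr_sumr; apply: ler_sum => i _.
    apply: ler_wpM2r => //.
    rewrite !natrD; have : (i.+1%:R <= k%:R :> R) by rewrite ler_nat.
    rewrite -natr1; have := ler0n R N; have := ler0n R i; lra.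
  have N'0 : 0 < N'%:R :> R by exact: N0.
  rewrite -(ler_pM2r N'0) /B -/N -/N'.
  have -> : L.+1%:R * (W N' / N'%:R) * N'%:R = L.+1%:R * W N'.
    by field; rewrite gt_eqF.
  have : L.+1%:R * W N <= L%:R * (W N / N%:R) * N'%:R.
    rewrite [leRHS](_ : _ = W N / N%:R * (L%:R * N'%:R)); last by ring.
    apply: le_trans (ler_wpM2l (B0 j) (lacunary_ratio_ge j L0)).
    rewrite -/N /B -/N [leRHS](_ : _ = L.+1%:R * W N)//.
    by field; rewrite gt_eqF//; exact: N0.
  have : L.+1%:R * (W N' - W N) <= L.+1%:R * (4 * N'%:R * (Gam N' - Gam N)).
    by rewrite ler_pM2l.
  lra.
(* The term [L%:R * B j] is the potential that pays for the next step: [step] trades it for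
   [L.+1%:R * B j.+1]. *)
have claim j : \sum_(i < j.+1) B i + L%:R * B j <=
    L.+1%:R * (W 1%N + 4 * Gam (lacunary L j)).
  elim: j => [|j IH].
    rewrite big_ord_recl big_ord0 addr0 /= /B /= divr1 -[X in X + _]mul1r -mulrDl.
    rewrite [1 + _]addrC natr1 ler_pM2l// lerDl mulr_ge0//; exact: sumr_ge0.
  by rewrite big_ord_recr /=; have := step j; rewrite -natr1 in IH *; lra.
case: J => [|J].
  rewrite big_ord0 mulr_ge0// addr_ge0// mulr_ge0//.
  by have := GC 0%N; rewrite big_ord0.
apply: (@le_trans _ _ (\sum_(i < J.+1) B i + L%:R * B J)).
  by rewrite lerDl mulr_ge0.
apply: le_trans (claim J) _; rewrite ler_pM2l// lerD2l ler_pM2l//; exact: GC.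
Qed.

(** Partial sums of a nonnegative sequence increase, so between two lacunary indices the mean
    changes by at most their ratio, which is close to 1 for large [L]. This is where nonnegativity
    is essential. *)
Lemma lacunary_cesaro (h : nat -> R) (l : R) : (forall n, 0 <= h n) -> 0 <= l ->
  (forall L, (0 < L)%N ->
    (fun j => (\sum_(n < lacunary L j) h n) / (lacunary L j)%:R) @ \oo --> l) ->
  (fun N => N.+1%:R^-1 * \sum_(n < N.+1) h n) @ \oo --> l.
Proof.
move=> h0 l0 hl.
pose S n := \sum_(i < n) h i.
have Smono m n : (m <= n)%N -> S m <= S n.
  by move=> /subnKC <-; rewrite /S big_split_ord /= lerDl sumr_ge0.
apply/cvgrPdist_le => e e0.
(* Chosen so that [(l + del) * (1 + del) <= l + e] and, when [e < l],
   [(l - e) * (1 + del) <= l - del]. *)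
pose del := Num.min 1 (e / (l + 2)).
have del0 : 0 < del by rewrite lt_min ltr01 divr_gt0//; lra.
have del1 : del <= 1 by rewrite ge_min lexx.
have dele : del * (l + 2) <= e.
  by rewrite -ler_pdivlMr; [rewrite ge_min lexx orbT|lra].
(* With [L > 2 / del] the ratio bound [1 + 2 / L] is at most [1 + del]. *)
pose L := (Num.trunc (2 / del)).+1.
have L0 : (0 < L)%N by [].
have LR0 : 0 < L%:R :> R by rewrite ltr0n.
have Ldel : L.+2%:R <= L%:R * (1 + del).
  have : 2 / del < L%:R by exact: truncnS_gt.
  rewrite ltr_pdivrMr// => h2; rewrite -addn2 natrD mulrDr mulr1; lra.
have /cvgrPdist_le/(_ del del0)[j0 _ j0P] := hl L L0.
exists (lacunary L (maxn j0 L)) => // K /= jK.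
have [j jge /andP[jK1 jK2]] := lacunary_between (leqW jK).
have j0j : (j0 <= j)%N by rewrite (leq_trans (leq_maxl _ _) jge).
have Lj : (L <= j)%N by rewrite (leq_trans (leq_maxr _ _) jge).
have /= H1 := j0P j j0j; have /= H2 := j0P j.+1 (leqW j0j).
rewrite -/(S _) in H1; rewrite -[\sum_(n < _) h n]/(S (lacunary L j.+1)) in H2.
have ratio := lacunary_ratio_le L0 Lj.
have Sj := Smono _ _ jK1; have Sj1 := Smono _ _ (ltnW jK2).
have S0 n : 0 <= S n by exact: sumr_ge0.
move: H1 H2 ratio Sj Sj1 jK1 jK2; rewrite -[_ L j.+1]/(lacunary L j.+1).
set N := lacunary L j; set N' := lacunary L j.+1.
have N0 : 0 < N%:R :> R by rewrite ltr0n (leq_ltn_trans _ (lacunary_gt L j)).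
have N'0 : 0 < N'%:R :> R by rewrite ltr0n (leq_ltn_trans _ (lacunary_gt L j.+1)).
move=> H1 H2 ratio Sj Sj1 jK1 jK2.
have K0 : 0 < K.+1%:R :> R by [].
have NK : N%:R <= K.+1%:R :> R by rewrite ler_nat.
have KN' : K.+1%:R <= N'%:R :> R by rewrite ler_nat ltnW.
have N'N : N'%:R <= (1 + del) * N%:R.
  rewrite -(ler_pM2l LR0) (le_trans ratio)// mulrA ler_pM2r//.
have SN : (l - del) * N%:R <= S N.
  by rewrite -ler_pdivlMr//; move: H1; rewrite ler_norml; lra.
have SN' : S N' <= (l + del) * N'%:R.
  by rewrite -ler_pdivrMr//; move: H2; rewrite ler_norml; lra.
rewrite -/(S K.+1) mulrC ler_distl; apply/andP; split.
  rewrite lerBlDr ler_pdivrMr// (le_trans Sj1)// (le_trans SN')//.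
  apply: (@le_trans _ _ ((l + e) * N%:R)); last by rewrite ler_wpM2l//; lra.
  apply: (@le_trans _ _ ((l + del) * ((1 + del) * N%:R))); first by rewrite ler_wpM2l//; lra.
  by rewrite mulrA ler_pM2r//; nra.
rewrite -lerBlDr ler_pdivlMr//; have [le|el] := lerP l e.
  by rewrite (@le_trans _ _ 0)// mulr_le0_ge0//; lra.
rewrite (le_trans _ Sj)// (le_trans _ SN)//.
apply: (@le_trans _ _ ((l - e) * ((1 + del) * N%:R))).
  by rewrite ler_wpM2l//; lra.
by rewrite mulrA ler_pM2r//; nra.
Qed.

End lacunary.

(** * Komlos' theorem *)

Section densities.
Context d (T : measurableType d) (R : realType) (P : probability T R).
Variable f : nat -> T -> R.
Hypotheses (mf : forall n, measurable_fun setT (f n)) (f0 : forall n x, 0 <= f n x).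
Local Notation E u := (Rintegral P setT u).

Lemma measurable_clip a n : measurable_fun setT (fun x => clip a (f n x)).
Proof. by apply: measurable_minr => //; exact: measurable_cst. Qed.

Lemma bounded_mfun_clip a n : bounded_mfun (fun x => clip a (f n x)).
Proof.
by apply: (@bounded_mfun_ge0 _ _ _ _ a%:R); [exact: measurable_clip|move=> x; exact: clip_bounds].
Qed.

Lemma bounded_mfun_layer a n : bounded_mfun (fun x => layer a (f n x)).
Proof. by apply: bounded_mfunB; exact: bounded_mfun_clip. Qed.

Definition layer_density (U : set_system nat) (q : nat -> T -> R) :=
  [/\ forall a, measurable_fun setT (q a), forall a x, 0 <= q a x <= 1 &
    forall a u, bounded_mfun u ->
      (fun n => E (fun x => u x * layer a (f n x))) @ U --> E (fun x => u x * q a x)].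

(** A single ultrafilter above [\oo] serves all layers and all test functions. Once the limits
    exist, the selections rely only on properness and on refining [\oo]. *)
Lemma layer_density_exists : exists U q,
  [/\ ProperFilter U, \oo `<=` U & layer_density U q].
Proof.
have [U [UU ooU]] := @ultraFilterLemma nat \oo _.
have /choice[q qP] : forall a, exists q : T -> R, [/\ measurable_fun setT q,
    (forall x, 0 <= q x <= 1) & forall u, bounded_mfun u ->
    (fun n => E (fun x => u x * layer a (f n x))) @ U --> E (fun x => u x * q x)].
  move=> a; apply: weak_limit_density => //.
    by move=> n; exact: (bounded_mfun_layer a n).1.
  by move=> n x; exact: layer_bounds.
exists U, q; split => //; first exact: ultra_proper.
by split => a; have [] := qP a.
Qed.

Variables (U : set_system nat) (q : nat -> T -> R).
Hypotheses (UP : ProperFilter U) (Uq : layer_density U q).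

Definition clip_density a x := \sum_(b < a) q b x.

Lemma bounded_mfun_layer_density a : bounded_mfun (q a).
Proof. by have [mq q01 _] := Uq; exact: bounded_mfun_ge0 (q01 a). Qed.

Lemma bounded_mfun_clip_density a : bounded_mfun (clip_density a).
Proof. by apply: bounded_mfun_sum => b; exact: bounded_mfun_layer_density. Qed.

Lemma clip_densityP a u : bounded_mfun u ->
  (fun n => E (fun x => u x * clip a (f n x))) @ U -->
  E (fun x => u x * clip_density a x).
Proof.
move=> bu; have [_ _ qP] := Uq; elim: a => [|a IH].
  have e0 (g : T -> R) : g =1 (fun=> 0) -> E g = 0.
    by move=> g0; rewrite (eq_expect _ g0) expect_cst.
  rewrite [X in _ --> X]e0; last by move=> x; rewrite /clip_density big_ord0 mulr0.
  apply: (@eqfun_cvg _ _ _ (fun=> 0)); last exact: cvg_cst.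
  by move=> n; rewrite e0// => x; rewrite clip_sum// big_ord0 mulr0.
have -> : E (fun x => u x * clip_density a.+1 x) =
    E (fun x => u x * clip_density a x) + E (fun x => u x * q a x).
  rewrite -expectD; [|apply: bounded_mfunM => //; exact: bounded_mfun_clip_density|
                      apply: bounded_mfunM => //; exact: bounded_mfun_layer_density].
  by apply: eq_expect => x; rewrite /clip_density big_ord_recr mulrDr.
apply: (eqfun_cvg _ (cvgD IH (qP a u bu))) => n; rewrite fctE -expectD.
- by apply: eq_expect => x; rewrite -mulrDr /layer addrC subrK.
- by apply: bounded_mfunM => //; exact: bounded_mfun_clip.
- by apply: bounded_mfunM => //; exact: bounded_mfun_layer.
Qed.

Lemma clip_density_bounds a x : 0 <= clip_density a x <= a%:R.
Proof.
have [_ q01 _] := Uq; apply/andP; split.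
  by apply: sumr_ge0 => b _; have /andP[] := q01 b x.
rewrite -[a in a%:R]card_ord -sumr_const; apply: ler_sum => b _.
by have /andP[] := q01 b x.
Qed.

Lemma near_layer_le a u e : bounded_mfun u -> 0 < e ->
  \forall n \near U, E (fun x => u x * layer a (f n x)) <= E (fun x => u x * q a x) + e.
Proof.
move=> bu e0; have [_ _ qP] := Uq.
by apply: (cvgr_le _ (qP a u bu)); rewrite ltrDl.
Qed.

Lemma near_clip_le a u e : bounded_mfun u -> 0 < e ->
  \forall n \near U, E (fun x => u x * clip a (f n x)) <=
    E (fun x => u x * clip_density a x) + e.
Proof.
by move=> bu e0; apply: (cvgr_le _ (@clip_densityP a u bu)); rewrite ltrDl.
Qed.

(** One-sided, because the second moment of a sum only requires its cross terms to be bounded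
    above. *)
Lemma near_centered_layer_le a u e : bounded_mfun u -> 0 < e ->
  \forall n \near U, E (fun x => u x * (layer a (f n x) - q a x)) <= e.
Proof.
move=> bu e0; apply: filterS (near_layer_le a bu e0) => n h.
have bq := bounded_mfun_layer_density a; have bl := bounded_mfun_layer a n.
rewrite (eq_expect _ (fun x => mulrBr _ _ _)) expectB; auto.
by rewrite lerBlDl.
Qed.

Lemma near_centered_clip_le a u e : bounded_mfun u -> 0 < e ->
  \forall n \near U, E (fun x => u x * (clip a (f n x) - clip_density a x)) <= e.
Proof.
move=> bu e0; apply: filterS (near_clip_le a bu e0) => n h.
have bq := bounded_mfun_clip_density a; have bl := bounded_mfun_clip a n.
rewrite (eq_expect _ (fun x => mulrBr _ _ _)) expectB; auto.
by rewrite lerBlDl.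
Qed.

End densities.

(** * Second moment of a sum of almost uncorrelated variables *)

Section second_moment.
Context d (T : measurableType d) (R : realType) (P : probability T R).
Local Notation E u := (Rintegral P setT u).

(** In the expanded square, [Y n] meets its [n] predecessors, each twice. *)
Lemma expect_sq_sum_le (Y : nat -> T -> R) (v e : nat -> R) K :
  (forall n, bounded_mfun (Y n)) -> (forall n, E (fun x => Y n x ^+ 2) <= v n) ->
  (forall i n, (i < n)%N -> E (fun x => Y i x * Y n x) <= e n) ->
  E (fun x => (\sum_(n < K) Y n x) ^+ 2) <= \sum_(n < K) (v n + 2 * (n%:R * e n)).
Proof.
move=> bY Yv Ye; elim: K => [|K IH].
  rewrite big_ord0 (@eq_expect _ _ _ _ _ (fun=> 0)) ?expect_cst//.
  by move=> x; rewrite big_ord0 expr0n.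
have bS : bounded_mfun (fun x => \sum_(n < K) Y n x) by exact: bounded_mfun_sum.
have bYY i : bounded_mfun (fun x => Y i x * Y K x) by exact: bounded_mfunM.
rewrite big_ord_recr /=.
rewrite (@eq_expect _ _ _ _ _ (fun x => (\sum_(n < K) Y n x) ^+ 2 +
    (Y K x ^+ 2 + 2 * \sum_(n < K) (Y n x * Y K x)))); last first.
  by move=> x; rewrite big_ord_recr /= sqrrD -mulr_suml -mulr_natl; ring.
have bSY : bounded_mfun (fun x => \sum_(n < K) (Y n x * Y K x)) :=
  bounded_mfun_sum K bYY.
rewrite expectD; [|exact: bounded_mfunX|apply: bounded_mfunD].
  apply: lerD => //; rewrite expectD; [|exact: bounded_mfunX|exact: bounded_mfunZ].
  apply: lerD => //; rewrite expectZ// ler_pM2l// (expect_sum P K bYY).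
  rewrite mulr_natl -[X in _ *+ X]card_ord -sumr_const.
  by apply: ler_sum => i _; exact: Ye.
- exact: bounded_mfunX.
- exact: bounded_mfunZ.
Qed.

End second_moment.

(** * From layers to Cesaro means at a fixed point *)

Section komlos.
Context (R : realType).

Lemma sqr_cvg0 (u : nat -> R) : (fun n => u n ^+ 2) @ \oo --> 0 -> u @ \oo --> 0.
Proof.
move=> /cvgr0Pnorm_lt u2; apply/cvgr0Pnorm_lt => e e0.
apply: filterS (u2 (e ^+ 2) _) => [n|]; last exact: exprn_gt0.
by rewrite normrX ltr_pXn2r// nnegrE// ltW.
Qed.

Lemma sum_odd n : \sum_(a < n) (2 * a%:R + 1) = n%:R ^+ 2 :> R.
Proof.
elim: n => [|n IH]; first by rewrite big_ord0 expr0n.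
by rewrite big_ord_recr /= IH -natr1; ring.
Qed.

Lemma sum_inv_pronic_le n : \sum_(i < n) (i.+1%:R * i.+2%:R)^-1 <= 1 :> R.
Proof.
suff -> : \sum_(i < n) (i.+1%:R * i.+2%:R)^-1 = 1 - n.+1%:R^-1 :> R.
  by rewrite lerBlDr lerDl invr_ge0.
elim: n => [|n IH]; first by rewrite big_ord0 invr1 subrr.
rewrite big_ord_recr /= IH -[n.+2%:R]natr1 -[n.+1%:R]natr1; have n0 := ler0n R n.
by field; apply/andP; split; apply: lt0r_neq0; lra.
Qed.

(** Split [h n] into the centred truncation and [c n]. The layers tend to 0, so the truncation is
    eventually inactive and [c] converges to the limit [l]; the lacunary means of the centred part
    have summable squares, hence vanish. *)
Lemma cesaro_of_layers (h q : nat -> R) (C M : R) :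
  (forall n, 0 <= h n) -> (forall n, 0 <= q n) ->
  (forall n, \sum_(b < n) q b <= C) ->
  (forall n, \sum_(i < n) layer i (h i) <= M) ->
  (forall L, (0 < L)%N -> exists B : R, forall J, \sum_(j < J)
    ((\sum_(n < lacunary L j) (clip n.+1 (h n) - \sum_(b < n.+1) q b)) /
      (lacunary L j)%:R) ^+ 2 <= B) ->
  (fun N => N.+1%:R^-1 * \sum_(n < N.+1) h n) @ \oo -->
    limn (fun n => \sum_(b < n) q b).
Proof.
move=> h0 q0 qC layM lac.
pose beta n := \sum_(b < n) q b; set l := limn beta.
have betal : beta @ \oo --> l.
  apply: nondecreasing_is_cvgn; last by exists C => _ [n _ <-]; exact: qC.
  by apply/nondecreasing_seqP => n; rewrite /beta big_ord_recr/= lerDl.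
have l0 : 0 <= l.
  by apply: limr_ge; [exact: cvgP betal|apply: nearW => n; exact: sumr_ge0].
have lay0 : (fun n => layer n (h n)) @ \oo --> 0.
  apply: bounded_sums_cvg0 layM => n.
  by have /andP[] := layer_bounds n (h n).
pose c n := beta n.+1 + (h n - clip n.+1 (h n)).
have cl : c @ \oo --> l.
  have r0 : (fun n => h n - clip n.+1 (h n)) @ \oo --> 0.
    apply: (@cvg_trans _ ((fun=> 0 : R) @ \oo)); last exact: cvg_cst.
    apply: near_eq_cvg; apply: filterS (cvgr_lt _ lay0 _ ltr01) => n /layer_lt1 hn.
    by rewrite clip_id ?subrr// ltW.
  rewrite -[l]addr0; apply: (eqfun_cvg _ (cvgD _ r0)); last first.
    by move: betal; rewrite -cvg_shiftS; exact.
  by move=> n; rewrite fctE.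
have meanc := cesaro cl.
apply: lacunary_cesaro => // L L0; have [B HB] := lac L L0.
pose D j := (\sum_(n < lacunary L j) (clip n.+1 (h n) - \sum_(b < n.+1) q b)) /
  (lacunary L j)%:R.
have D0 : D @ \oo --> 0.
  by apply/sqr_cvg0/(@bounded_sums_cvg0 _ (fun j => D j ^+ 2) B) => // j; exact: sqr_ge0.
(* The mean at index [n] averages [n.+1] terms, hence the predecessor. *)
have prec : (fun j => (lacunary L j).-1) @ \oo --> \oo.
  apply/cvgnyPge => A; exists A => // j /= Aj.
  by rewrite -ltnS prednK ?(leq_ltn_trans _ (lacunary_gt L j))// (leq_ltn_trans Aj (lacunary_gt L j)).
have meanc' := @cvg_comp _ _ _ _ _ _ _ _ prec meanc.
rewrite -[l]add0r; apply: (eqfun_cvg _ (cvgD D0 meanc')) => j.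
rewrite fctE /= /arithmetic_mean /series /=.
have N0 : (0 < lacunary L j)%N by rewrite (leq_ltn_trans _ (lacunary_gt L j)).
rewrite prednK// big_mkord [_^-1 * _]mulrC -mulrDl -big_split /=; congr (_ / _).
by apply: eq_bigr => i _; rewrite /c /beta; ring.
Qed.

End komlos.

Section komlos_nonneg.
Context d (T : measurableType d) (R : realType) (P : probability T R).
Local Notation E u := (Rintegral P setT u).

Lemma expect_sq_layers_le (p : nat -> T -> R) n :
  (forall a, bounded_mfun (p a)) -> (forall a x, 0 <= p a x <= 1) ->
  E (fun x => (\sum_(a < n) p a x) ^+ 2) <=
  \sum_(a < n) (2 * a%:R + 1) * E (p a).
Proof.
move=> bp p01.
have bcp a : bounded_mfun (fun x => (2 * a%:R + 1) * p a x) by exact: bounded_mfunZ.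
apply: (@le_trans _ _ (E (fun x => \sum_(a < n) (2 * a%:R + 1) * p a x))).
  apply: le_expect.
  - exact: (bounded_mfunX 2 (bounded_mfun_sum n bp)).
  - exact: (bounded_mfun_sum n bcp).
  - by move=> x; exact: (@sum_sq_le R (fun a => p a x) n).
rewrite (expect_sum P n bcp); apply: ler_sum => a _.
by rewrite expectZ.
Qed.

Lemma komlos_nonneg (f : nat -> T -> R) (C : R) :
  (forall n, measurable_fun setT (f n)) -> (forall n x, 0 <= f n x) ->
  (forall n, (\int[P]_x (f n x)%:E <= C%:E)%E) ->
  exists (fs : T -> R) (m : nat -> nat),
    [/\ measurable_fun setT fs, strictly_incr m &
      forall psi, strictly_incr psi -> cesaro_ae P f (m \o psi) fs].
Proof.
move=> mf f0 fC.
have [U [q [UP ooU Uq]]] := layer_density_exists P mf f0.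
have [mq q01 _] := Uq.
have bq a : bounded_mfun (q a) := bounded_mfun_layer_density Uq a.
have bbeta a := bounded_mfun_clip_density Uq a.
have bclip a n := bounded_mfun_clip mf f0 a n.
have blayer a n := bounded_mfun_layer mf f0 a n.
have q0 a x : 0 <= q a x by have /andP[] := q01 a x.
pose G a := E (q a).
have G0 a : 0 <= G a by exact: expect_ge0.
have E1 (u : T -> R) : E (fun x => 1 * u x) = E u.
  by apply: eq_expect => x; rewrite mul1r.
have GC n : \sum_(a < n) G a <= C.
  rewrite -(expect_sum P n bq).
  have H := @clip_densityP _ _ _ P f mf f0 U q UP Uq n _ (bounded_mfun_cst T 1).
  rewrite -[E _](E1 (clip_density q n)) -(cvg_lim _ H)//; apply: limr_le; first exact: cvgP H.
  apply: nearW => k; rewrite -lee_fin expect_EFin; last by auto.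
  apply: le_trans (fC k); apply: ge0_le_integral => //.
  - by move=> x _; rewrite lee_fin mul1r; have /andP[] := clip_bounds n (f0 k x).
  - by apply/measurable_EFinP; apply: measurable_funM => //; exact: (bclip n k).1.
  - by apply/measurable_EFinP.
  - by move=> x _; rewrite lee_fin mul1r /clip ge_min lexx.
(* The error serves twice: its product with [N.+1 ^ 2], the sum of the weights [2 * a + 1], is at
   most 1, and it is summable over the diagonal layers with total at most 1. *)
pose S N n := forall a, (a < N.+1)%N ->
  E (fun x => layer a (f n x)) <= G a + (N.+1%:R * N.+2%:R)^-1.
(* All levels up to [M.+1] and [N.+1] are controlled, because a subsequence truncates the function
   of stage [psi n] at level [n.+1 <= (psi n).+1]. The error [N.+1%:R^-1] keeps the sum of the [n]
   cross terms of [Y n] below 1. *)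
pose Q M m N n := forall a, (a < M.+2)%N -> forall b, (b < N.+2)%N ->
  E (fun x => (clip a (f m x) - clip_density q a x) *
              (clip b (f n x) - clip_density q b x)) <= N.+1%:R^-1.
have US N : \forall n \near U, S N n.
  apply: near_forall_lt => a _.
  have e0 : 0 < (N.+1%:R * N.+2%:R)^-1 :> R by rewrite invr_gt0 mulr_gt0.
  apply: filterS (near_layer_le UP Uq a (bounded_mfun_cst T 1) e0) => n.
  by rewrite (E1 (fun x => layer a (f n x))) (E1 (q a)).
have UQ M k N : (M < N)%N -> \forall n \near U, Q M k N n.
  move=> _; apply: near_forall_lt => a _; apply: near_forall_lt => b _.
  by apply: (near_centered_clip_le mf f0 UP Uq); [auto|rewrite invr_gt0].
have [m [mS mP]] := diagonal_selection UP ooU US UQ.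
(* The limit is fixed before any [psi]. [limn_esup] is total and measurable, and [fine] gives 0 on
   the null set where the sum of the densities is infinite. *)
exists (fun x => fine (limn_esup (fun n => (clip_density q n x)%:E))), m; split => //.
  apply: measurableT_comp; first exact: fine_measurable.
  by apply: measurable_fun_limn_esup => n; apply/measurable_EFinP; exact: (bbeta n).1.
move=> psi psiS; pose h n x := f (m (psi n)) x.
pose Y n x := clip n.+1 (h n x) - clip_density q n.+1 x.
have bY n : bounded_mfun (Y n).
  by apply: bounded_mfunB; [exact: bclip|exact: bbeta].
have psi_ge n : (n <= psi n)%N := strictly_incr_ge psiS n.
have lay_le a n : (a <= n)%N ->
    E (fun x => layer a (h n x)) <= G a + (n.+1%:R * n.+2%:R)^-1.
  move=> an; have [S1 _] := mP (psi n).
  apply: (le_trans (S1 a _)); first by rewrite ltnS (leq_trans an).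
  rewrite lerD2l lef_pV2 ?posrE ?mulr_gt0// -!natrM ler_nat.
  by apply: leq_mul; rewrite !ltnS psi_ge.
(* The constant 3 is 1 for the errors of the layers in the second moment of [Y n], plus 2 for its
   doubled cross terms. *)
pose W n := 2 * \sum_(a < n) (2 * a%:R + 1) * G a + 3.
have Wmono n k : (n <= k)%N -> W n <= W k.
  move=> /subnKC <-; rewrite /W big_split_ord /= mulrDr addrAC lerDl.
  by rewrite mulr_ge0// sumr_ge0// => i _; rewrite mulr_ge0// addr_ge0// mulr_ge0.
have bl2 n : bounded_mfun (fun x => (\sum_(a < n.+1) layer a (h n x)) ^+ 2).
  exact: (bounded_mfunX 2 (bounded_mfun_sum n.+1 (fun a => blayer a _))).
have bq2 n : bounded_mfun (fun x => (\sum_(a < n.+1) q a x) ^+ 2).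
  exact: (bounded_mfunX 2 (bounded_mfun_sum n.+1 bq)).
have YW n : E (fun x => Y n x ^+ 2) <= W n.+1 - 2.
  apply: (@le_trans _ _ (E (fun x => (\sum_(a < n.+1) layer a (h n x)) ^+ 2 +
                                      (\sum_(a < n.+1) q a x) ^+ 2))).
    apply: le_expect.
    - exact: bounded_mfunX.
    - exact: bounded_mfunD.
    - move=> x; rewrite -clip_sum; last exact: f0.
      rewrite /Y -/(clip_density q n.+1 x).
      have /andP[c0 _] := clip_bounds n.+1 (f0 (m (psi n)) x).
      have /andP[b0 _] := clip_density_bounds Uq n.+1 x.
      rewrite -/(h n x) in c0; nra.
  rewrite (expectD P (bl2 n) (bq2 n)).
  have H1 := @expect_sq_layers_le (fun a x => layer a (h n x)) n.+1
    (fun a => blayer a _) (fun a x => layer_bounds a _).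
  have H2 := @expect_sq_layers_le q n.+1 bq q01.
  have H3 : \sum_(a < n.+1) (2 * a%:R + 1) * E (fun x => layer a (h n x)) <=
      \sum_(a < n.+1) (2 * a%:R + 1) * G a + 1.
    apply: (@le_trans _ _ (\sum_(a < n.+1) ((2 * a%:R + 1) * G a +
        (2 * a%:R + 1) * (n.+1%:R * n.+2%:R)^-1))).
      apply: ler_sum => a _; rewrite -mulrDr ler_wpM2l ?addr_ge0 ?mulr_ge0//.
      by apply: lay_le; rewrite -ltnS.
    rewrite big_split /= lerD2l -mulr_suml sum_odd ler_pdivrMr ?mulr_gt0// mul1r.
    by rewrite expr2 ler_pM2l// ler_nat.
  by rewrite /W -/(G _); move: H1 H2 H3; rewrite -/G; lra.
have YY i n : (i < n)%N -> E (fun x => Y i x * Y n x) <= n.+1%:R^-1.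
  move=> i_n; have [_ S2] := mP (psi n).
  apply: (le_trans (S2 (psi i) (strictly_incr_lt psiS i_n) i.+1 _ n.+1 _)).
  - by rewrite !ltnS.
  - by rewrite !ltnS.
  - by rewrite lef_pV2 ?posrE// ler_nat ltnS.
have SK K : E (fun x => (\sum_(n < K) Y n x) ^+ 2) <= K%:R * W K.
  apply: le_trans (expect_sq_sum_le K bY YW YY) _.
  rewrite -[K in K%:R * _]card_ord mulr_natl -sumr_const; apply: ler_sum => n _.
  apply: le_trans (Wmono n.+1 K (ltn_ord n)).
  have : n%:R / n.+1%:R <= 1 :> R by rewrite ler_pdivrMr// mul1r ler_nat.
  by move: (W _) (_ / _) => w r; lra.
have bS K : bounded_mfun (fun x => \sum_(n < K) Y n x) := bounded_mfun_sum K bY.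
have aeL : {ae P, forall x, forall L, (0 < L)%N -> exists B : R, forall J, \sum_(j < J)
    ((\sum_(n < lacunary L j) Y n x) / (lacunary L j)%:R) ^+ 2 <= B}.
  apply: ae_foralln => L; case: L => [|L]; first by apply: nearW.
  have /= := @ae_bounded_sums _ _ _ P (fun j x => ((\sum_(n < lacunary L.+1 j) Y n x) /
    (lacunary L.+1 j)%:R) ^+ 2) (L.+2%:R * (W 1%N + 4 * C)).
  move=> H; apply: filterS (H _ _ _) => //.
  - by move=> n; apply: bounded_mfunX; exact: (bounded_mfunM (bS _) (bounded_mfun_cst T _)).
  - by move=> n x; exact: sqr_ge0.
  move=> J; apply: le_trans (@lacunary_sum_bounded R L.+1 W W G C _ G0 GC J) => //.
  apply: ler_sum => j _; set N := lacunary _ _.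
  have N0 : 0 < N%:R :> R by rewrite ltr0n (leq_ltn_trans _ (lacunary_gt _ _)).
  rewrite (@eq_expect _ _ _ _ _ (fun x => (N%:R^-1 ^+ 2) * (\sum_(n < N) Y n x) ^+ 2)).
    rewrite expectZ; last exact: bounded_mfunX.
    apply: le_trans (ler_wpM2l (sqr_ge0 _) (SK N)) _.
    rewrite le_eqVlt; apply/orP; left; apply/eqP.
    by rewrite -/(W N); move: (W N) (N%:R : R) N0 => w r r0; field; rewrite gt_eqF.
  by move=> x; rewrite exprMn mulrC.
have aeq : {ae P, forall x, exists M, forall n, \sum_(i < n) q i x <= M}.
  exact: ae_bounded_sums GC.
(* Only the diagonal layers [i] of [h i] are needed: their expectations sum to at most [C], plus 1
   for the errors. *)
have aelay : {ae P, forall x, exists M, forall n, \sum_(i < n) layer i (h i x) <= M}.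
  apply: (@ae_bounded_sums _ _ _ P (fun i x => layer i (h i x)) (C + 1)).
  - by move=> n; exact: blayer.
  - by move=> n x; have /andP[] := layer_bounds n (h n x).
  - move=> n; apply: (@le_trans _ _ (\sum_(i < n) (G i + (i.+1%:R * i.+2%:R)^-1))).
      by apply: ler_sum => i _; exact: lay_le.
    by rewrite big_split /=; apply: lerD; [exact: GC|exact: sum_inv_pronic_le].
apply: filterS3 aeL aeq aelay => x HL [C' HC] [M HM].
have H := cesaro_of_layers (fun n => f0 (m (psi n)) x) (fun n => q0 n x) HC HM HL.
set l := limn _ in H.
suff -> : limn_esup (fun n => (clip_density q n x)%:E) = l%:E by exact: H.
apply: (cvg_limn_einf_sup _).2; apply/fine_cvgP; split; first exact: nearW.
apply: nondecreasing_is_cvgn; last by exists C' => _ [n _ <-]; exact: HC.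
by apply/nondecreasing_seqP => n; rewrite /= /clip_density big_ord_recr/= lerDl.
Qed.

End komlos_nonneg.

Section komlos_theorem.
Context d (T : measurableType d) (R : realType) (P : probability T R).

(** The nonnegative case is applied to the positive parts and then, along the indices obtained, to
    the negative parts. The first convergence survives the second extraction because it holds along
    every subsequence. *)
Theorem komlos (f : nat -> T -> R) :
  (forall n, measurable_fun setT (f n)) ->
  (ereal_sup (range (fun n => \int[P]_x (`|f n x|)%:E)) < +oo)%E ->
  exists (fs : T -> R) (phi : nat -> nat),
    [/\ measurable_fun setT fs, strictly_incr phi & hereditary_cesaro P f phi fs].
Proof.
move=> mf supf.
have [C fC] : exists C : R, forall n, (\int[P]_x (`|f n x|)%:E <= C%:E)%E.
  exists (fine (ereal_sup (range (fun n => \int[P]_x (`|f n x|)%:E)%E))) => n.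
  have le_sup : (\int[P]_x (`|f n x|)%:E <=
      ereal_sup (range (fun n => \int[P]_x (`|f n x|)%:E)))%E.
    by apply: ereal_sup_ubound; exists n.
  rewrite fineK// ge0_fin_numE//; apply: le_trans le_sup.
  by apply: integral_ge0 => x _; rewrite lee_fin.
have part_le (g : R -> R) : (forall y, 0 <= g y <= `|y|) -> measurable_fun setT g ->
    forall n, (\int[P]_x (g (f n x))%:E <= C%:E)%E.
  move=> gb mg n; apply: le_trans (fC n); apply: ge0_le_integral => //.
  - by move=> x _; rewrite lee_fin; have /andP[] := gb (f n x).
  - by apply/measurable_EFinP; exact: measurableT_comp.
  - by apply/measurable_EFinP; exact: measurableT_comp.
  - by move=> x _; rewrite lee_fin; have /andP[] := gb (f n x).
pose pos (y : R) := Num.max y 0; pose neg (y : R) := Num.max (- y) 0.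
have pos_b y : 0 <= pos y <= `|y|.
  by rewrite /pos le_max lexx orbT ge_max ler_norm normr_ge0.
have neg_b y : 0 <= neg y <= `|y|.
  by rewrite /neg le_max lexx orbT ge_max normr_ge0 -normrN ler_norm.
have mpos : measurable_fun setT pos.
  by apply: measurable_maxr; [exact: measurable_id|exact: measurable_cst].
have mneg : measurable_fun setT neg.
  by apply: measurable_maxr; [exact: oppr_measurable|exact: measurable_cst].
have [f1 [m1 [mf1 m1S H1]]] := @komlos_nonneg _ _ _ P (fun n x => pos (f n x)) C
  (fun n => measurableT_comp mpos (mf n)) (fun n x => (andP (pos_b (f n x))).1)
  (part_le pos pos_b mpos).
have [f2 [m2 [mf2 m2S H2]]] := @komlos_nonneg _ _ _ P (fun n x => neg (f (m1 n) x)) C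
  (fun n => measurableT_comp mneg (mf (m1 n))) (fun n x => (andP (neg_b (f (m1 n) x))).1)
  (fun n => part_le neg neg_b mneg (m1 n)).
exists (fun x => f1 x - f2 x), (m1 \o m2); split.
- exact: measurable_funB.
- exact: strictly_incr_comp.
suff H psi : strictly_incr psi -> cesaro_ae P f (m1 \o m2 \o psi) (fun x => f1 x - f2 x).
  by split; [exact: (H id)|exact: H].
move=> psiS; apply: filterS2 (H1 _ (strictly_incr_comp m2S psiS)) (H2 psi psiS).
move=> x c1 c2; apply: (eqfun_cvg _ (cvgB c1 c2)) => N.
rewrite !fctE /cesaro -mulrBr; congr (_ * _).
rewrite -sumrB; apply: eq_bigr => i _ /=; rewrite /pos /neg.
by rewrite /Num.max; case: ifPn; case: ifPn; lra.
Qed.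

End komlos_theorem.

(** * Equivalent probability measures *)

Lemma sum_geometric_le (R : realType) n : \sum_(j < n) 2^-1 ^+ j <= 2 :> R.
Proof.
suff -> : \sum_(j < n) 2^-1 ^+ j = 2 - 2 * 2^-1 ^+ n :> R.
  by rewrite gerBl mulr_ge0// exprn_ge0// invr_ge0.
elim: n => [|n IH]; first by rewrite big_ord0 expr0; lra.
by rewrite big_ord_recr /= IH exprS; lra.
Qed.

Section equivalent_measure.
Context d (T : measurableType d) (R : realType).

Lemma ge0_integral_mrestr (mu : {measure set T -> \bar R}) (A : set T)
    (mA : measurable A) (f : T -> \bar R) :
  measurable_fun setT f -> (forall x, 0 <= f x)%E ->
  (\int[mrestr mu mA]_x f x = \int[mu]_(x in A) f x)%E.
Proof.
move=> mf f0; rewrite -(setUv A) ge0_integral_setU//; last 3 first.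
- exact: measurableC.
- by rewrite setUv.
- by apply/disj_setPS; rewrite setICr.
rewrite [X in (_ + X)%E](_ : _ = 0%E).
  rewrite adde0; apply: eq_measure_integral => B mB BA.
  by rewrite -[LHS]/(mu (B `&` A)) setIidl.
rewrite -(integral_measure_zero (~` A) f); apply: eq_measure_integral => B mB BA.
rewrite -[LHS]/(mu (B `&` A)).
by rewrite (_ : B `&` A = set0) ?measure0// -subset0 => x [/BA].
Qed.

Lemma nneseries_le_geometric (a : nat -> \bar R) :
  (forall j, 0 <= a j <= (2^-1 ^+ j)%:E)%E -> (\sum_(0 <= j <oo) a j <= 2%:E)%E.
Proof.
move=> ab; apply: lime_le.
  by apply: is_cvg_nneseries => j _ _; have /andP[] := ab j.
apply: nearW => n; apply: (@le_trans _ _ (\sum_(0 <= j < n) (2^-1 ^+ j)%:E)%E).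
  by apply: lee_sum => j _; have /andP[] := ab j.
by rewrite sumEFin lee_fin big_mkord sum_geometric_le.
Qed.

Variable P : probability T R.

(** [Q] is the normalised sum of the restrictions of [P] to the [A j] with weights [c j]. It has the
    null sets of [P] because the [A j] exhaust the space, and the weights absorb the local [L^1]
    bounds. *)
Lemma equivalent_probability (f : nat -> T -> R) (A : nat -> set T) :
  (forall n, measurable_fun setT (f n)) -> exhausting P A ->
  (forall j, (ereal_sup (range (fun n =>
     \int[P]_x ((`|f n x| * \1_(A j) x)%:E))) < +oo)%E) ->
  exists Q : probability T R, [/\ Q `<< P, P `<< Q &
    (ereal_sup (range (fun n => \int[Q]_x (`|f n x|)%:E)) < +oo)%E].
Proof.
move=> mf [mA [incA PA1]] supf.
pose p : {measure set T -> \bar R} := P.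
pose b j n := (\int[P]_x ((`|f n x| * \1_(A j) x)%:E))%E.
have b0 j n : (0 <= b j n)%E.
  by apply: integral_ge0 => x _; rewrite lee_fin mulr_ge0.
have /choice[M MP] : forall j, exists M : R, 0 <= M /\ forall n, (b j n <= M%:E)%E.
  move=> j; exists (fine (ereal_sup (range (b j)))).
  have le_sup n : (b j n <= ereal_sup (range (b j)))%E.
    by apply: ereal_sup_ubound; exists n.
  have sup0 : (0 <= ereal_sup (range (b j)))%E by exact: le_trans (b0 j 0%N) (le_sup 0%N).
  split; first exact: fine_ge0.
  by move=> n; rewrite fineK// ge0_fin_numE//; exact: supf.
(* Both [c j] and [c j * M j] are at most [2^-1 ^+ j]: the first makes the mass finite, the second
   the integrals uniformly bounded. *)
pose c j := 2^-1 ^+ j / (1 + M j).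
have M1 j : 0 < 1 + M j by have [M0 _] := MP j; rewrite ltr_pwDl.
have c0 j : 0 < c j by rewrite divr_gt0// exprn_gt0// invr_gt0.
have cle j : c j <= 2^-1 ^+ j.
  have [M0 _] := MP j; rewrite ler_pdivrMr// ler_peMr ?exprn_ge0 ?invr_ge0//.
  by rewrite lerDl.
pose m_ j : {measure set T -> \bar R} :=
  mscale (NngNum (ltW (c0 j))) (mrestr P (mA j)).
pose mu : {measure set T -> \bar R} := mseries m_ 0.
have muE S : mu S = (\sum_(0 <= j <oo) (c j)%:E * p (S `&` A j))%E by [].
have int_mu g : measurable_fun setT g -> (forall x, 0 <= g x)%E ->
    (\int[mu]_x g x = \sum_(0 <= j <oo) (c j)%:E * \int[P]_(x in A j) g x)%E.
  move=> mg g0; rewrite /mu ge0_integral_measure_series//.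
  apply: eq_eseriesr => j _; rewrite ge0_integral_mscale//.
  by congr (_ * _)%E; exact: ge0_integral_mrestr.
have mu_ge j S : ((c j)%:E * p (S `&` A j) <= mu S)%E.
  rewrite muE; apply: le_trans (nneseries_lim_ge j.+1 _); last first.
    by move=> i _ _; rewrite mule_ge0// lee_fin ltW.
  rewrite big_nat_recr//= leeDr// sume_ge0// => i _.
  by rewrite mule_ge0// lee_fin ltW.
have c_null j S : ((c j)%:E * p (S `&` A j) <= 0 -> p (S `&` A j) = 0)%E.
  move=> h; apply/eqP; rewrite eq_le measure_ge0 andbT.
  by rewrite -(@lee_pmul2l _ (c j)%:E) ?mule0// lte_fin c0.
(* Such an [S] has the same mass as [S] minus [A j], at most [1 - p (A j)], which tends to 0. *)
have P_null S : measurable S -> (forall j, p (S `&` A j) = 0%E) -> p S = 0%E.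
  move=> mS PS0; apply/eqP; rewrite eq_le measure_ge0 andbT.
  have : (fun j => 1 - p (A j))%E @ \oo --> (1 - 1)%E.
    by apply: cvgeB => //; exact: cvg_cst.
  rewrite subee// => cvg0; apply: (cvge_ge _ cvg0); apply: nearW => j.
  have -> : p S = p (S `\` A j).
    by rewrite [LHS](measureDI p mS (mA j)) [X in (_ + X)%E](PS0 j) adde0.
  rewrite -[X in (_ <= X)%E](probability_setC P (mA j) : p (~` A j) = _); apply: le_measure; rewrite ?inE.
  - exact: measurableD.
  - exact: measurableC.
  - exact: subIsetr.
have muT : (0 < mu setT < +oo)%E.
  apply/andP; split; last first.
    apply: (@le_lt_trans _ _ 2%:E); last exact: ltry.
    rewrite muE; apply: nneseries_le_geometric => j.
    rewrite mule_ge0 ?lee_fin ?(ltW (c0 j))//=.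
    apply: (@le_trans _ _ (c j)%:E); last by rewrite lee_fin.
    by rewrite -[leRHS]mule1 lee_wpmul2l ?lee_fin ?(ltW (c0 j))// probability_le1// setTI.
  rewrite lt_neqAle measure_ge0 andbT eq_sym; apply/eqP => mu0.
  suff : p setT = 0%E.
    by rewrite (probability_setT P : p setT = 1%E) => /eqP; rewrite eqe oner_eq0.
  by apply: P_null => // j; apply: c_null; rewrite -mu0 mu_ge.
have nullE S : measurable S -> (mu S = 0 <-> p S = 0)%E.
  move=> mS; split => [muS0|pS0]; last first.
    rewrite muE eseries0// => j _ _.
    rewrite (_ : p (S `&` A j) = 0%E) ?mule0//.
    apply: (subset_measure0 (measurableI _ _ mS (mA j)) mS _ pS0).
    exact: subIsetl.
  by apply: P_null => // j; apply: c_null; rewrite -muS0 mu_ge.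
pose r := (fine (mu setT))^-1.
have r0 : 0 <= r by rewrite invr_ge0 fine_ge0.
have QE S : mnormalize mu P S = (r%:E * mu S)%E.
  rewrite /mnormalize; have /andP[mu0 muoo] := muT.
  by rewrite gt_eqF// lt_eqF//= muleC.
have rgt0 : 0 < r.
  by have /andP[mu0 muoo] := muT; rewrite invr_gt0 fine_gt0// mu0.
have Q_null S : (mnormalize mu P S = 0 <-> mu S = 0)%E.
  rewrite QE; split => [/eqP|->]; last by rewrite mule0.
  by rewrite mule_eq0 eqe gt_eqF//= => /eqP.
exists (mnormalize mu P); split.
- apply/null_content_dominatesP => S mS PS0.
  by apply/Q_null; apply/(nullE S mS).
- apply/null_content_dominatesP => S mS /Q_null; exact: (nullE S mS).1.
apply: (@le_lt_trans _ _ (r * 2)%:E); last exact: ltry.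
apply: ge_ereal_sup => _ [n _ <-].
rewrite (eq_measure_integral (mscale (NngNum r0) mu)); last by move=> S _ _; exact: QE.
have mfn : measurable_fun setT (fun x => (`|f n x|)%:E).
  by apply/measurable_EFinP; exact: measurableT_comp.
rewrite ge0_integral_mscale// EFinM lee_wpmul2l ?lee_fin//.
rewrite int_mu//; apply: nneseries_le_geometric => j.
have [M0 bM] := MP j.
have -> : (\int[P]_(x in A j) (`|f n x|)%:E = b j n)%E.
  rewrite integral_mkcond; apply: eq_integral => x _.
  by rewrite /patch indicE; case: (x \in A j); rewrite ?mulr1 ?mulr0.
rewrite mule_ge0 ?lee_fin ?(ltW (c0 j))//=.
apply: (@le_trans _ _ ((c j)%:E * (M j)%:E)%E).
  by rewrite lee_wpmul2l ?lee_fin ?(ltW (c0 j)).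
rewrite -EFinM lee_fin /c -mulrA ler_piMr ?exprn_ge0 ?invr_ge0//.
by rewrite mulrC ler_pdivrMr// mul1r lerDr.
Qed.

Lemma exhausting_cover (A : nat -> set T) : (forall j, measurable (A j)) ->
  (forall j, A j `<=` A j.+1) -> {ae P, forall x, exists j, A j x} ->
  exhausting P A.
Proof.
move=> mA incA aeA; split => //; split => //.
have mU : measurable (\bigcup_j A j) by exact: bigcup_measurable.
have -> : 1%E = (P : {measure set T -> \bar R}) (\bigcup_j A j).
  have PU : (P : {measure set T -> \bar R}) (~` \bigcup_j A j) = 0%E.
    apply/(measure_negligible (measurableC mU)); apply: negligibleS aeA => x /=.
    by apply: contra_not => -[j Ax]; exists j.
  have := probability_setC P (measurableC mU).
  by rewrite setCK [X in (_ - X)%E]PU sube0.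
apply: nondecreasing_cvg_mu => //.
by apply/nondecreasing_seqP => j; apply/subsetPset; exact: incA.
Qed.

(** [A j] is the set where the density of [P] with respect to [Q] is at most [j]. The density is
    finite everywhere, so these sets cover the space, and on [A j] an integral against [P] is at
    most [j] times the one against [Q]. *)
Lemma exhausting_of_equivalent (Q : probability T R) (f : nat -> T -> R) :
  (forall n, measurable_fun setT (f n)) -> P `<< Q ->
  (ereal_sup (range (fun n => \int[Q]_x (`|f n x|)%:E)) < +oo)%E ->
  exists A, exhausting P A /\ forall j, (ereal_sup (range (fun n =>
     \int[P]_x ((`|f n x| * \1_(A j) x)%:E))) < +oo)%E.
Proof.
move=> mf PQ supf.
pose p : {finite_measure set T -> \bar R} := P.
pose q : {sigma_finite_measure set T -> \bar R} := Q.
have pq : p `<< q by exact: PQ.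
pose g := Radon_Nikodym_SigmaFinite.f p q.
have g_fin x : g x \is a fin_num := Radon_Nikodym_SigmaFinite.f_fin_num pq x.
have g0 x : (0 <= g x)%E := Radon_Nikodym_SigmaFinite.f_ge0 pq x.
have mg : measurable_fun setT g := measurable_int _ (Radon_Nikodym_SigmaFinite.f_integrable pq).
pose A j := [set x | (g x <= j%:R%:E)%E].
have mA j : measurable (A j).
  by rewrite -[A j]setTI; exact: emeasurable_fun_infty_c.
exists A; split.
  apply: exhausting_cover => //.
    by move=> j x; rewrite /A /= => /le_trans; apply; rewrite lee_fin ler_nat.
  apply: nearW => x; exists (Num.trunc (fine (g x))).+1; rewrite /A /=.
  by rewrite -[g x]fineK// lee_fin ltW// truncnS_gt.
move=> j; set S := ereal_sup _ in supf.
have le_S n : (\int[Q]_x (`|f n x|)%:E <= S)%E by apply: ereal_sup_ubound; exists n.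
have S0 : (0 <= S)%E.
  by apply: le_trans (le_S 0%N); apply: integral_ge0 => x _; rewrite lee_fin.
apply: (@le_lt_trans _ _ (j%:R%:E * S)%E); last first.
  by rewrite lte_mul_pinfty// ?lee_fin.
apply: ge_ereal_sup => _ [n _ <-].
have mfn : measurable_fun setT (fun x => (`|f n x|)%:E).
  by apply/measurable_EFinP; exact: measurableT_comp.
have mfA : measurable_fun setT (fun x => (`|f n x| * \1_(A j) x)%:E).
  apply/measurable_EFinP; apply: measurable_funM; last exact: measurable_indic.
  exact: measurableT_comp.
have h0 x : (0 <= (`|f n x| * \1_(A j) x)%:E)%E by rewrite lee_fin mulr_ge0.
rewrite -[leLHS](Radon_Nikodym_SigmaFinite.change_of_variables pq h0 measurableT mfA).
apply: (@le_trans _ _ (\int[Q]_x (j%:R%:E * (`|f n x|)%:E))%E); last first.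
  by rewrite ge0_integralZl// ?lee_fin// lee_wpmul2l ?lee_fin.
apply: ge0_le_integral => //.
- by move=> x _; rewrite mule_ge0.
- exact: emeasurable_funM.
- exact: emeasurable_funM.
move=> x _; rewrite -/(g x) indicE; have [/set_mem xA|_] := boolP (x \in A j).
  by rewrite mulr1 muleC lee_wpmul2r ?lee_fin.
by rewrite mulr0 mul0e mule_ge0 ?lee_fin.
Qed.

End equivalent_measure.

(** * The converse *)

Section converse_deterministic.
Context (R : realType).

(** A term is the difference of two consecutive partial sums, each close to its length times [l], so
    it grows slower than its index. *)
Lemma cesaro_cvg_le (a : nat -> R) (l : R) :
  (fun N => N.+1%:R^-1 * \sum_(n < N.+1) a n) @ \oo --> l ->
  exists N0, forall N, (N0 <= N)%N -> `|a N| <= N%:R.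
Proof.
move=> /cvgrPdist_le/(_ 4^-1)[]; first by rewrite invr_gt0.
move=> N1 _ HN1.
have S_le N : (N1 <= N)%N ->
    `|\sum_(n < N.+1) a n - N.+1%:R * l| <= 4^-1 * N.+1%:R.
  move=> N1N; have := HN1 N N1N.
  rewrite /= distrC => h; have N0 : 0 < N.+1%:R :> R by [].
  rewrite -ler_pdivrMr// -[X in _ / X]gtr0_norm// -normf_div.
  by rewrite mulrBl mulrC [N.+1%:R * l]mulrC mulfK ?gt_eqF.
(* The term is at most [(N.+2 + N.+1) / 4 + |l|] in absolute value, hence at most [N.+1] once
   [2 * |l| + 1 <= N.+1]. *)
exists (maxn N1.+1 (Num.trunc (2 * `|l| + 1)).+1) => -[|N]; first by rewrite leqNgt leq_max.
rewrite geq_max ltnS => /andP[N1N lN].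
have lN' : 2 * `|l| + 1 <= N.+1%:R.
  by apply/ltW; rewrite (lt_le_trans (truncnS_gt _))// ler_nat.
have h1 := S_le N N1N; have h2 := S_le N.+1 (leqW N1N).
rewrite big_ord_recr /= in h2.
have -> : a N.+1 = (\sum_(n < N.+1) a n + a N.+1 - N.+2%:R * l) -
    (\sum_(n < N.+1) a n - N.+1%:R * l) + l.
  by rewrite -[N.+2%:R]natr1; ring.
apply: le_trans (ler_normD _ _) _; apply: le_trans (lerD (ler_normB _ _) (lexx _)) _.
move: h1 h2 lN'; rewrite -[N.+2%:R]natr1; move: (N.+1%:R : R) => n.
move: `|_ - (n + 1) * l| `|_ - n * l| `|l| => x y z; lra.
Qed.

(** With [w] the weight and [beta] the partial sums, [1 + beta n] is the product of the factors
    [1 + w b * q b], so it is at most the exponential of the weighted sum. That sum is bounded along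
    arbitrarily large [K], since [y] vanishes from [N0] on. *)
Lemma density_sum_bounded (q y : nat -> R) (M : R) (N0 : nat) :
  (forall n, 0 <= q n) -> (forall N, (N0 <= N)%N -> y N = 0) ->
  (forall N, exists2 K, (N <= K)%N &
    (\sum_(n < K) (1 + \sum_(b < n) q b)^-1 * (y n - q n)) ^+ 2 <= M) ->
  exists C, forall n, \sum_(b < n) q b <= C.
Proof.
move=> q0 y0 HM; pose beta n := \sum_(b < n) q b; pose w n := (1 + beta n)^-1.
have beta_mono m n : (m <= n)%N -> beta m <= beta n.
  by move=> /subnKC <-; rewrite /beta big_split_ord /= lerDl sumr_ge0.
have beta0 n : 0 <= beta n by exact: sumr_ge0.
have w0 n : 0 < 1 + beta n by rewrite ltr_pwDl.
have exp_ge n : 1 + beta n <= expR (\sum_(b < n) w b * q b).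
  elim: n => [|n IH]; first by rewrite /beta !big_ord0 addr0 expR0.
  rewrite /beta !big_ord_recr /= expRD addrA -/(beta n).
  have -> : 1 + beta n + q n = (1 + beta n) * (1 + w n * q n).
    by rewrite mulrDr mulr1 mulrA /w divff ?mul1r// gt_eqF.
  by apply: ler_pM => //; [exact: ltW|rewrite addr_ge0// mulr_ge0// invr_ge0 ltW|exact: expR_ge1Dx].
pose B := \sum_(n < N0) w n * y n.
exists (expR (B + (M + 1))) => n.
have [K nK HK] := HM (maxn N0 n).
have N0K : (N0 <= K)%N by exact: leq_trans (leq_maxl _ _) nK.
apply: le_trans (beta_mono n K (leq_trans (leq_maxr _ _) nK)) _.
have -> : beta K = 1 + beta K - 1 by rewrite addrAC subrr add0r.
rewrite lerBlDr (le_trans (exp_ge K))// (@le_trans _ _ (expR (B + (M + 1))))//; last by rewrite lerDl.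
rewrite ler_expR.
have : \sum_(n < K) w n * (y n - q n) = B - \sum_(b < K) w b * q b.
  under eq_bigr do rewrite mulrBr.
  rewrite sumrB; congr (_ - _); rewrite -(subnKC N0K) big_split_ord /=.
  by rewrite [X in _ + X]big1 ?addr0// => i _; rewrite y0 ?mulr0// leq_addr.
move: HK; rewrite -/(w _) => + HS; rewrite [X in X ^+ 2]HS.
set s := \sum_(b < K) w b * q b => h.
(* Any real [z] satisfies [z <= z ^ 2 + 1 / 4]; here [z = s - B] has square at most [M]. *)
by have := sqr_ge0 (s - B - 2^-1); rewrite expr2 in h *; lra.
Qed.

End converse_deterministic.

Section converse.
Context d (T : measurableType d) (R : realType) (P : probability T R).
Local Notation E u := (Rintegral P setT u).

Lemma bounded_mfun_inv1D (u : T -> R) : measurable_fun setT u ->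
  (forall x, 0 <= u x) -> bounded_mfun (fun x => (1 + u x)^-1).
Proof.
move=> mu u0; apply: (@bounded_mfun_ge0 _ _ _ _ 1).
  have -> : (fun x => (1 + u x)^-1) = (fun x => (1 + u x) `^ (-1)).
    by apply/funext => x; rewrite powR_inv1// addr_ge0.
  by apply: (measurableT_comp (measurable_powR (-1))); exact: measurable_funD.
move=> x; have u1 : 1 <= 1 + u x by rewrite lerDl.
by rewrite invr_ge0 (le_trans ler01 u1) invf_le1// (lt_le_trans ltr01).
Qed.

(** Two selections are made. The first, [m], shows that [\sum_b q b] is finite almost everywhere.
    The second, [phi], starts afresh from [U] and uses the limit weight [u], by then known to be
    positive almost everywhere, to obtain the bound. *)
Lemma converse_komlos (f : nat -> T -> R) (fs : T -> R) :
  (forall n, measurable_fun setT (f n)) ->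
  (forall psi, strictly_incr psi -> cesaro_ae P f psi fs) ->
  exists (A : nat -> set T) (phi : nat -> nat),
    [/\ exhausting P A, strictly_incr phi & locally_L1_bounded P f phi A].
Proof.
move=> mf hf; pose F n x := `|f n x|.
have mF n : measurable_fun setT (F n) by exact: measurableT_comp.
have F0 n x : 0 <= F n x by exact: normr_ge0.
have [U [q [UP ooU Uq]]] := layer_density_exists P mF F0.
have [mq q01 _] := Uq.
have q0 a x : 0 <= q a x by have /andP[] := q01 a x.
have q1 a x : q a x <= 1 by have /andP[] := q01 a x.
have bq a : bounded_mfun (q a) := bounded_mfun_layer_density Uq a.
have bbeta a : bounded_mfun (clip_density q a) := bounded_mfun_clip_density Uq a.
have beta0 a x : 0 <= clip_density q a x by have /andP[] := clip_density_bounds Uq a x.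
have blayer a n := bounded_mfun_layer mF F0 a n.
have bclip a n := bounded_mfun_clip mF F0 a n.
have betaS a x : clip_density q a.+1 x = clip_density q a x + q a x.
  by rewrite /clip_density big_ord_recr.
pose w n x := (1 + clip_density q n x)^-1.
have bw n : bounded_mfun (w n) by apply: bounded_mfun_inv1D; [exact: (bbeta n).1|].
have beta1 n x : 0 < 1 + clip_density q n x by rewrite ltr_pwDl.
have w0 n x : 0 < w n x by rewrite invr_gt0.
have wS n x : w n.+1 x <= w n x.
  by rewrite lef_pV2 ?posrE// betaS lerD2l lerDl.
(* The difference of consecutive weights is [q / ((1 + b) * (1 + b + q))], and
   [1 + b + q <= 2 * (1 + b)] since [q <= 1]. The sum over [n] therefore telescopes, whatever the
   size of [\sum_b q b]. *)
have ww n x : w n x ^+ 2 * q n x <= 2 * (w n x - w n.+1 x).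
  rewrite /w betaS; move: (beta1 n x) (beta0 n x) (q0 n x) (q1 n x).
  move: (clip_density q n x) (q n x) => b r b1 b0 r0 r1.
  rewrite -subr_ge0; have br : 0 < 1 + (b + r) by lra.
  have -> : 2 * ((1 + b)^-1 - (1 + (b + r))^-1) - (1 + b)^-1 ^+ 2 * r =
      r * (1 + b - r) / ((1 + b) ^+ 2 * (1 + (b + r))).
    by field; rewrite !gt_eqF.
  apply: divr_ge0; apply: mulr_ge0; [by []|lra|exact: sqr_ge0|exact: ltW].
pose S N n := E (fun x => w N x ^+ 2 * layer N (F n x)) <=
  E (fun x => w N x ^+ 2 * q N x) + 2^-1 ^+ N.
pose X N n x := w N x * (layer N (F n x) - q N x).
have bX N n : bounded_mfun (X N n).
  by apply: bounded_mfunM => //; exact: bounded_mfunB.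
pose Q M m N n := E (fun x => X M m x * X N n x) <= 2^-1 ^+ N / N.+1%:R.
have US N : \forall n \near U, S N n.
  by apply: (near_layer_le UP Uq); [exact: bounded_mfunX|rewrite exprn_gt0// invr_gt0].
have UQ M m N : (M < N)%N -> \forall n \near U, Q M m N n.
  move=> _; have e0 : 0 < 2^-1 ^+ N / N.+1%:R :> R by rewrite divr_gt0// exprn_gt0// invr_gt0.
  have bu : bounded_mfun (fun x => X M m x * w N x) by exact: bounded_mfunM.
  apply: filterS (near_centered_layer_le mF F0 UP Uq N bu e0) => n.
  by rewrite /Q; under eq_Rintegral do rewrite -mulrA.
have [m [mS mP]] := diagonal_selection UP ooU US UQ.
have sumw K : \sum_(n < K) E (fun x => w n x ^+ 2 * q n x) <= 2.
  have bwq n : bounded_mfun (fun x => w n x ^+ 2 * q n x).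
    by apply: bounded_mfunM => //; exact: bounded_mfunX.
  rewrite -(expect_sum P K bwq) -[leRHS](expect_cst P); apply: le_expect.
  - exact: (bounded_mfun_sum K bwq).
  - exact: bounded_mfun_cst.
  move=> x; apply: (@le_trans _ _ (2 * (w 0%N x - w K x))).
    elim: K => [|K IH]; first by rewrite big_ord0 subrr mulr0.
    by rewrite big_ord_recr /=; have := ww K x; lra.
  have : w 0%N x = 1 by rewrite /w /clip_density big_ord0 addr0 invr1.
  by have := w0 K x; lra.
have X2 n : E (fun x => X n (m n) x ^+ 2) <=
    2 * E (fun x => w n x ^+ 2 * q n x) + 2^-1 ^+ n.
  have [S1 _] := mP n.
  have bl : bounded_mfun (fun x => w n x ^+ 2 * layer n (F (m n) x)).
    by apply: bounded_mfunM => //; exact: bounded_mfunX.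
  have bwq : bounded_mfun (fun x => w n x ^+ 2 * q n x).
    by apply: bounded_mfunM => //; exact: bounded_mfunX.
  apply: (@le_trans _ _ (E (fun x => w n x ^+ 2 * layer n (F (m n) x) + w n x ^+ 2 * q n x))).
    apply: le_expect; [exact: bounded_mfunX|exact: bounded_mfunD|move=> x].
    rewrite /X exprMn -mulrDr ler_wpM2l ?sqr_ge0//.
    have /andP[] := layer_bounds n (F (m n) x); have := q0 n x; have := q1 n x.
    move: (layer _ _) (q n x) => y r; nra.
  by rewrite expectD//; move: S1; rewrite /S; lra.
have XX i n : (i < n)%N -> E (fun x => X i (m i) x * X n (m n) x) <= 2^-1 ^+ n / n.+1%:R.
  by have [_] := mP n; exact.
have ZE K : E (fun x => (\sum_(n < K) X n (m n) x) ^+ 2) <= 10.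
  apply: le_trans (expect_sq_sum_le K (fun n => bX n (m n)) X2 XX) _.
  (* One error [2^-1 ^+ n] comes from the layer in [X2] and two from the doubled cross terms. The
     total is at most [2 * 2 + 3 * 2 = 10]. *)
  apply: (@le_trans _ _ (\sum_(n < K) (2 * E (fun x => w n x ^+ 2 * q n x) + 3 * 2^-1 ^+ n))).
    apply: ler_sum => n _; rewrite -addrA lerD2l.
    have : n%:R * (2^-1 ^+ n / n.+1%:R) <= 2^-1 ^+ n :> R.
      rewrite mulrCA ler_piMr ?exprn_ge0 ?invr_ge0// ler_pdivrMr// mul1r ler_nat//.
    by move: (2^-1 ^+ n) (n%:R * _) => a b; lra.
  rewrite big_split /= -!mulr_sumr.
  by have := sumw K; have := @sum_geometric_le R K; lra.
have aebeta : {ae P, forall x, exists C, forall n, clip_density q n x <= C}.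
  have aeZ := ae_frequently_bounded
    (fun K => bounded_mfunX 2 (bounded_mfun_sum K (fun n => bX n (m n))))
    (fun K x => sqr_ge0 _) ZE.
  apply: filterS2 aeZ (hf m mS) => x [M HM] hx.
  have [N0 HN0] := @cesaro_cvg_le _ (fun n => f (m n) x) _ hx.
  apply: (@density_sum_bounded R (fun n => q n x) (fun n => layer n (F (m n) x)) M N0) => //.
  by move=> N N0N; apply: layer_eq0; exact: HN0.
(* [u] is the reciprocal of one plus the full sum of the [q b], and 0 where that sum diverges.
   Defined as a limit of the decreasing [w n], it is below each of them, whence
   [u * clip_density q a <= 1]. *)
pose u x := limn (w^~ x).
have wcvg x : w^~ x @ \oo --> u x.
  apply: nonincreasing_is_cvgn; first by apply/nonincreasing_seqP => n; exact: wS.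
  by exists 0 => _ [n _ <-]; exact: ltW.
have u_le n x : u x <= w n x.
  apply: limr_le; first exact: cvgP (wcvg x).
  exists n => // k /= nk; rewrite -(subnKC nk).
  elim: (k - n)%N => [|i IH]; first by rewrite addn0.
  by rewrite addnS (le_trans (wS _ _) IH).
have u0 x : 0 <= u x.
  by apply: limr_ge; [exact: cvgP (wcvg x)|apply: nearW => n; exact: ltW].
have mu : measurable_fun setT u.
  by apply: (measurable_fun_cvg (fun n => (bw n).1)) => x _; exact: wcvg.
have bu : bounded_mfun u.
  apply: (@bounded_mfun_ge0 _ _ _ _ 1) => // x; rewrite u0 (le_trans (u_le 0%N x))//.
  by rewrite /w /clip_density big_ord0 addr0 invr1.
have ubeta a : E (fun x => u x * clip_density q a x) <= 1.
  rewrite -[leRHS](expect_cst P); apply: le_expect; auto => x.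
  apply: (@le_trans _ _ (w a x * clip_density q a x)); first by rewrite ler_wpM2r.
  by rewrite mulrC ler_pdivrMr// mul1r lerDr.
have aeu : {ae P, forall x, 0 < u x}.
  apply: filterS aebeta => x [C HC].
  have C0 : 0 <= C by apply: le_trans (HC 0%N).
  have C1 : 0 < 1 + C by rewrite ltr_pwDl.
  apply: (@lt_le_trans _ _ (1 + C)^-1); first by rewrite invr_gt0.
  apply: limr_ge; first exact: cvgP (wcvg x).
  by apply: nearW => n; rewrite lef_pV2 ?posrE// lerD2l.
(* The first condition makes the weighted diagonal layers summable, with total at most [1 + 2 = 3].
   The second is the weighted [L^1] bound of the truncations, with limit value at most 1 and error
   1. *)
pose S' i n := E (fun x => u x * layer i (F n x)) <= E (fun x => u x * q i x) + 2^-1 ^+ i /\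
  E (fun x => u x * clip i.+1 (F n x)) <= 2.
have US' i : \forall n \near U, S' i n.
  have e0 : 0 < 2^-1 ^+ i :> R by rewrite exprn_gt0// invr_gt0.
  apply: filterS2 (near_layer_le UP Uq i bu e0) (near_clip_le mF F0 UP Uq i.+1 bu ltr01).
  by move=> n h1 h2; split => //; apply: le_trans h2 _; have := ubeta i.+1; lra.
have [phi [phiS phiP]] := diagonal_selection (Q := fun _ _ _ _ => True) UP ooU US'
  (fun _ _ _ _ => nearW _ (fun=> I)).
have bul i : bounded_mfun (fun x => u x * layer i (F (phi i) x)) by exact: bounded_mfunM.
have aelay : {ae P, forall x, exists M, forall n,
    \sum_(i < n) u x * layer i (F (phi i) x) <= M}.
  apply: (@ae_bounded_sums _ _ _ P (fun i x => u x * layer i (F (phi i) x)) 3) => //.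
  - by move=> i x; rewrite mulr_ge0//; have /andP[] := layer_bounds i (F (phi i) x).
  - move=> n; apply: (@le_trans _ _ (\sum_(i < n) (E (fun x => u x * q i x) + 2^-1 ^+ i))).
      by apply: ler_sum => i _; have [[]] := phiP i.
    have buq i : bounded_mfun (fun x => u x * q i x) by exact: bounded_mfunM.
    rewrite big_split /= -(expect_sum P n buq).
    under eq_Rintegral do rewrite -mulr_sumr.
    by have := ubeta n; have := @sum_geometric_le R n; rewrite /clip_density; lra.
(* On [A j] the weight is at least [1 / j.+1] and the function exceeds its truncation at [i.+1] by
   at most [j]. This gives the bound [j.+1 * 2 + j] for every [i]. *)
pose A j := [set x | 1 <= j.+1%:R * u x] `&` \bigcap_i [set x | F (phi i) x <= (i.+1 + j)%:R].
have mle (g h : T -> R) : measurable_fun setT g -> measurable_fun setT h ->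
    measurable [set x | g x <= h x].
  move=> mg mh; rewrite -[X in measurable X]setTI.
  by have /(_ measurableT [set true]) := measurable_fun_ler mg mh; exact.
have mA j : measurable (A j).
  apply: measurableI; first by apply: mle => //; exact: measurable_funM.
  by apply: bigcapT_measurable => i; exact: mle.
exists A, phi; split => //.
- apply: exhausting_cover => //.
  + move=> j x [/= h1 h2]; split => /=.
      by apply: le_trans h1 _; rewrite ler_wpM2r// ler_nat.
    by move=> i _; apply: le_trans (h2 i I) _; rewrite /= ler_nat addnS.
  apply: filterS2 aeu aelay => x ux [M HM].
  have lay0 : (fun i => u x * layer i (F (phi i) x)) @ \oo --> 0.
    apply: bounded_sums_cvg0 HM => i.
    by rewrite mulr_ge0//; have /andP[] := layer_bounds i (F (phi i) x).
  have [N0 _ HN0] := cvgr_lt _ lay0 _ ux.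
  (* [B] dominates both [1 / u x] and the finitely many values with [i < N0]; from [N0] on, the
     layer is below 1 and the value below [i.+1]. *)
  pose B := (u x)^-1 + \sum_(i < N0) F (phi i) x.
  have B0 : 0 <= \sum_(i < N0) F (phi i) x by exact: sumr_ge0.
  exists (Num.trunc B).+1.
  have Bt : B < (Num.trunc B).+1%:R by exact: truncnS_gt.
  split => /=.
    rewrite -ler_pdivrMr// mul1r; apply: (@le_trans _ _ B); first by rewrite lerDl.
    by rewrite (le_trans (ltW Bt))// ler_nat.
  move=> i _ /=; have [iN|Ni] := ltnP i N0.
    apply: (@le_trans _ _ B); last by rewrite (le_trans (ltW Bt))// ler_nat leq_addl.
    rewrite /B (bigD1 (Ordinal iN))//= addrCA lerDl addr_ge0 ?invr_ge0 ?(ltW ux)//.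
    by apply: sumr_ge0.
  have := HN0 i Ni; rewrite /= gtr_pMr// => /layer_lt1 /ltW/le_trans; apply.
  by rewrite ler_nat leq_addr.
move=> j; apply: (@le_lt_trans _ _ (j.+1%:R * 2 + j%:R)%:E); last exact: ltry.
apply: ge_ereal_sup => _ [i _ <-].
have bc : bounded_mfun (fun x => u x * clip i.+1 (F (phi i) x)) by exact: bounded_mfunM.
have bg : bounded_mfun (fun x => j.+1%:R * (u x * clip i.+1 (F (phi i) x)) + j%:R).
  by apply: bounded_mfunD; [exact: bounded_mfunZ|exact: bounded_mfun_cst].
have Eg : E (fun x => j.+1%:R * (u x * clip i.+1 (F (phi i) x)) + j%:R) <= j.+1%:R * 2 + j%:R.
  rewrite expectD; [|exact: bounded_mfunZ|exact: bounded_mfun_cst].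
  rewrite expect_cst lerD2r expectZ// ler_pM2l//.
  by have [[_ ]] := phiP i.
rewrite -lee_fin expect_EFin// in Eg; apply: le_trans Eg.
have clip0 x : 0 <= clip i.+1 (F (phi i) x) by have /andP[] := clip_bounds i.+1 (F0 (phi i) x).
apply: ge0_le_integral => //.
- apply/measurable_EFinP; apply: measurable_funM => //; exact: (mF (phi i)).
- by apply/measurable_EFinP; exact: bg.1.
move=> x _; rewrite lee_fin indicE; have [/set_mem[/= h1 h2]|_] := boolP (x \in A j).
  rewrite mulr1 mulrA; apply: (@le_trans _ _ (1 * clip i.+1 (F (phi i) x) + j%:R)).
    have := h2 i I; rewrite /= natrD mul1r /clip -/(F (phi i) x) /Num.min.
    by case: ifPn => _ h; [rewrite lerDl|exact: h].
  by rewrite lerD2r ler_wpM2r.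
by rewrite mulr0 addr_ge0// mulr_ge0// mulr_ge0.
Qed.

End converse.

(** * Transfer between equivalent measures and the three statements *)

Lemma ae_null_dominates d (T : measurableType d) (R : realType)
    (P Q : probability T R) (B : T -> Prop) :
  P `<< Q -> {ae Q, forall x, B x} -> {ae P, forall x, B x}.
Proof.
move=> PQ [N [mN QN0 BN]]; exists N; split => //.
exact: ((null_content_dominatesP P Q).1 PQ).
Qed.

Theorem theorem2p1 (d : measure_display) (T : measurableType d) (R : realType)
  (P : probability T R) (f : nat -> T -> R)
  (mf : forall n, measurable_fun setT (f n)) :
  (* (i) *)
  (forall (k : nat -> nat) (A : nat -> set T),
     strictly_incr k -> exhausting P A -> locally_L1_bounded P f k A ->
     exists (fs : T -> R) (phi : nat -> nat),
       measurable_fun setT fs /\ strictly_incr phi /\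
       hereditary_cesaro P f (k \o phi) fs)
  /\
  (* (ii) *)
  (forall (k : nat -> nat) (fs : T -> R),
     strictly_incr k -> measurable_fun setT fs -> hereditary_cesaro P f k fs ->
     exists (A : nat -> set T) (phi : nat -> nat),
       exhausting P A /\ strictly_incr phi /\
       locally_L1_bounded P f (k \o phi) A)
  /\
  (* (iii) *)
  ((exists (k : nat -> nat) (A : nat -> set T),
      strictly_incr k /\ exhausting P A /\ locally_L1_bounded P f k A)
   <->
   (exists (Q : probability T R) (k : nat -> nat),
      (Q `<< P /\ P `<< Q) /\ strictly_incr k /\
      (ereal_sup (range (fun n => \int[Q]_x (`|f (k n) x|)%:E)) < +oo)%E)).
Proof.
split; [|split; [|split]].
(* Komlos' theorem is applied under [Q], where the bound is global; the almost everywhere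
   convergence returns to [P] through absolute continuity. *)
- move=> k A kS PA fA.
  have [Q [QP PQ supQ]] := equivalent_probability (fun n => mf (k n)) PA fA.
  have [fs [phi [mfs phiS [H0 H]]]] := komlos (fun n => mf (k n)) supQ.
  exists fs, phi; split => //; split => //; split; first exact: ae_null_dominates PQ H0.
  by move=> psi psiS; exact: ae_null_dominates PQ (H psi psiS).
- move=> k fs kS mfs [_ H].
  have [A [phi [PA phiS fA]]] := @converse_komlos _ _ _ P (fun n => f (k n)) fs (fun n => mf (k n)) H.
  by exists A, phi.
- move=> [k [A [kS [PA fA]]]].
  have [Q [QP PQ supQ]] := equivalent_probability (fun n => mf (k n)) PA fA.
  by exists Q, k.
move=> [Q [k [[QP PQ] [kS supQ]]]].
have [A [PA fA]] := exhausting_of_equivalent (fun n => mf (k n)) PQ supQ.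
by exists k, A.
Qed.
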